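(* Consider the setting described in the context, and assume A1–A5. Let the sequence of alternatives $f_n$ be consistent and let $f_{1n}$ be any inconsistent sequence of alternatives. Then for every $\alpha\in(0,1)$ and every sequence of tests $K_n$ generated by $T_n$ with $\alpha(K_n)=\alpha(1+o(1))$, $$\lim_{n\to\infty}\big(\beta(K_n,f_n)-\beta(K_n,f_n+f_{1n})\big)=0 .$$
   Context: Fix $\sigma>0$, $0<r<1/2$ and an orthonormal basis $(\phi_j)_{j\ge1}$ of $\mathbb{L}_2(0,1)$. For each $n$ one observes $dY_n(t)=f(t)\,dt+\sigma n^{-1/2}dw(t)$, equivalently $y_j=\theta_j+\sigma n^{-1/2}\xi_j$, $\theta_j=\int_0^1f\phi_j$, $\xi_j$ i.i.d. $N(0,1)$; $H_0:f=0$. Weights $\kappa_{nj}^2\ge0$, $\rho_n=\sum_j\kappa_{nj}^2$, $T_n(Y_n)=\sum_j\kappa_{nj}^2y_j^2-\sigma^2n^{-1}\rho_n$, $k_n=\sup\{k:\sum_{j<k}\kappa_{nj}^2\le\rho_n/2\}$, $\kappa_n^2=\kappa_{nk_n}^2$. Assumptions: (A1) $j\mapsto\kappa_{nj}^2$ decreasing; (A2) $C_1<\sigma^{-4}n^2\sum_j\kappa_{nj}^4<C_2$; (A3) $c_1n^{-2r}\le\rho_n\le c_2n^{-2r}$; (A4) $\exists C_1>0,\lambda>1$: $\kappa^2_{n,[(1+\delta)k_n]}<C_1(1+\delta)^{-\lambda}\kappa_n^2$ for all $\delta>0,n$; (A5) $\kappa_{n1}^2\asymp\kappa_n^2$ and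 for each $c>1$ there is $C>0$ with $\kappa^2_{n,[ck_n]}\ge C\kappa_n^2$. A test generated by $T_n$ rejects $H_0$ iff $T_n$ exceeds a threshold; $\alpha(K)$, $\beta(K,f)$ are type I and type II error probabilities. A sequence $f_n$ is consistent if for every $\alpha\in(0,1)$ and every sequence of tests $K_n$ generated by $T_n$ with $\alpha(K_n)=\alpha(1+o(1))$, $\limsup_n\beta(K_n,f_n)<1-\alpha$; it is inconsistent if for every sequence of tests $K_n$ generated by $T_n$, $\liminf_n(\alpha(K_n)+\beta(K_n,f_n))\ge1$. *)

(* Defs.v *)
From HB Require Import structures.
From mathcomp Require Import all_boot all_order all_algebra.
From mathcomp Require Import all_classical all_reals all_analysis.
Set Implicit Arguments.
Unset Strict Implicit.
Unset Printing Implicit Defensive.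
Import Order.TTheory GRing.Theory Num.Theory.
Import numFieldNormedType.Exports.
Local Open Scope classical_set_scope.
Local Open Scope ring_scope.

(* Indices j of the basis / weights are 1-based: only j >= 1 is used;
   the value at index 0 is irrelevant. *)

Definition L2_01 {R : realType} (f : R -> R) : Prop :=
  measurable_fun (`[0%R, 1%R] : set R) f /\
  lebesgue_measure.-integrable (`[0%R, 1%R] : set R) (fun x => ((f x) ^+ 2)%:E).

Definition inner01 {R : realType} (f g : R -> R) : R :=
  Rintegral lebesgue_measure (`[0%R, 1%R] : set R) (fun x => f x * g x).

Definition orthonormal_basis {R : realType} (phi : nat -> R -> R) : Prop :=
  [/\ (forall j, (1 <= j)%N -> L2_01 (phi j)),
      (forall i j, (1 <= i)%N -> (1 <= j)%N ->
         inner01 (phi i) (phi j) = (i == j)%:R) &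
      (forall f, L2_01 f -> (forall j, (1 <= j)%N -> inner01 f (phi j) = 0) ->
         {ae lebesgue_measure, forall x, 0 <= x <= 1 -> f x = 0})].

Definition coef {R : realType} (phi : nat -> R -> R) (f : R -> R) (j : nat) : R :=
  inner01 f (phi j).

Definition iid_std_normal {R : realType} {d : measure_display}
    {Omega : measurableType d} (P : probability Omega R)
    (xi : nat -> Omega -> R) : Prop :=
  [/\ (forall j, (1 <= j)%N -> measurable_fun setT (xi j)),
      (forall j (A : set R), (1 <= j)%N -> measurable A ->
         P (xi j @^-1` A) = normal_prob 0 1 A) &
      (forall (J : seq nat) (B : nat -> set R), uniq J ->
         (forall j, j \in J -> (1 <= j)%N) -> (forall j, measurable (B j)) ->
         P (\bigcap_(j in [set j | j \in J]) (xi j @^-1` B j)) =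
         (\prod_(j <- J) P (xi j @^-1` B j))%E)].

Definition rho {R : realType} (kappa2 : nat -> nat -> R) (n : nat) : \bar R :=
  (\sum_(1 <= j <oo) (kappa2 n j)%:E)%E.

Definition kn {R : realType} (kappa2 : nat -> nat -> R) (n : nat) : nat :=
  Num.truncn (sup [set (k%:R : R) | k in
     [set k : nat | ((\sum_(1 <= j < k) kappa2 n j)%:E <=
                      rho kappa2 n * (2^-1)%:E)%E]]).

Definition kappan2 {R : realType} (kappa2 : nat -> nat -> R) (n : nat) : R :=
  kappa2 n (kn kappa2 n).

(* T_n(Y_n) with y_j = theta_j + sigma n^{-1/2} xi_j *)
Definition Tstat {R : realType} {d : measure_display} {Omega : measurableType d}
    (sigma : R) (kappa2 : nat -> nat -> R) (xi : nat -> Omega -> R)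
    (theta : nat -> R) (n : nat) (w : Omega) : \bar R :=
  ((\sum_(1 <= j <oo)
      (kappa2 n j * (theta j + sigma / Num.sqrt n%:R * xi j w) ^+ 2)%:E)
   - (sigma ^+ 2 / n%:R)%:E * rho kappa2 n)%E.

(* type I error of the test rejecting iff T_n > t *)
Definition alpha_err {R : realType} {d : measure_display} {Omega : measurableType d}
    (P : probability Omega R) (sigma : R) (kappa2 : nat -> nat -> R)
    (xi : nat -> Omega -> R) (n : nat) (t : R) : R :=
  fine (P [set w | (t%:E < Tstat sigma kappa2 xi (fun _ => 0%R) n w)%E]).

Definition beta_err {R : realType} {d : measure_display} {Omega : measurableType d}
    (P : probability Omega R) (sigma : R) (kappa2 : nat -> nat -> R)
    (xi : nat -> Omega -> R) (n : nat) (t : R) (theta : nat -> R) : R :=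
  fine (P [set w | (Tstat sigma kappa2 xi theta n w <= t%:E)%E]).

Definition consistent {R : realType} {d : measure_display} {Omega : measurableType d}
    (P : probability Omega R) (sigma : R) (kappa2 : nat -> nat -> R)
    (xi : nat -> Omega -> R) (phi : nat -> R -> R) (f : nat -> R -> R) : Prop :=
  forall a : R, 0 < a < 1 -> forall t : nat -> R,
    (fun n => alpha_err P sigma kappa2 xi n (t n)) @ \oo --> a ->
    (limn_esup (fun n => (beta_err P sigma kappa2 xi n (t n) (coef phi (f n)))%:E)
       < (1 - a)%:E)%E.

Definition inconsistent {R : realType} {d : measure_display} {Omega : measurableType d}
    (P : probability Omega R) (sigma : R) (kappa2 : nat -> nat -> R)
    (xi : nat -> Omega -> R) (phi : nat -> R -> R) (f : nat -> R -> R) : Prop :=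
  forall t : nat -> R,
    (1 <= limn_einf (fun n => (alpha_err P sigma kappa2 xi n (t n)
                      + beta_err P sigma kappa2 xi n (t n) (coef phi (f n)))%:E))%E.

Definition A1 {R : realType} (kappa2 : nat -> nat -> R) : Prop :=
  forall n i j, (1 <= i)%N -> (i <= j)%N -> kappa2 n j <= kappa2 n i.

Definition A2 {R : realType} (sigma : R) (kappa2 : nat -> nat -> R) : Prop :=
  exists C1 C2 : R, 0 < C1 /\ forall n, (0 < n)%N ->
    (C1%:E < (sigma ^- 4 * (n%:R) ^+ 2)%:E * \sum_(1 <= j <oo) ((kappa2 n j) ^+ 2)%:E)%E /\
    ((sigma ^- 4 * (n%:R) ^+ 2)%:E * \sum_(1 <= j <oo) ((kappa2 n j) ^+ 2)%:E < C2%:E)%E.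

Definition A3 {R : realType} (r : R) (kappa2 : nat -> nat -> R) : Prop :=
  exists c1 c2 : R, 0 < c1 /\ 0 < c2 /\ forall n, (0 < n)%N ->
    ((c1 * (n%:R) `^ (- (2 * r)))%:E <= rho kappa2 n)%E /\
    (rho kappa2 n <= (c2 * (n%:R) `^ (- (2 * r)))%:E)%E.

Definition A4 {R : realType} (kappa2 : nat -> nat -> R) : Prop :=
  exists C1 lam : R, 0 < C1 /\ 1 < lam /\
    forall (delta : R) n, 0 < delta -> (0 < n)%N ->
      kappa2 n (Num.truncn ((1 + delta) * (kn kappa2 n)%:R))
        < C1 * (1 + delta) `^ (- lam) * kappan2 kappa2 n.

Definition A5 {R : realType} (kappa2 : nat -> nat -> R) : Prop :=
  (exists c C : R, 0 < c /\ 0 < C /\ forall n, (0 < n)%N ->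
      c * kappan2 kappa2 n <= kappa2 n 1%N <= C * kappan2 kappa2 n) /\
  (forall c : R, 1 < c -> exists C : R, 0 < C /\ forall n, (0 < n)%N ->
      C * kappan2 kappa2 n <= kappa2 n (Num.truncn (c * (kn kappa2 n)%:R))).

(* Main.v *)
(** After rescaling, [T_n <= t] is the event that the weighted noncentral
    chi-square [\sum_j a_j (h_j + X_j)^2] is at most [x], where
    [\sum_j a_j^2] is bounded above and below and, by (A1)-(A3) and (A5),
    [max_j a_j] tends to [0]. Adding a signal [h] shifts the central form by
    the energy [D = \sum_j a_j h_j^2] up to a centred error of variance at most
    [4 (max_j a_j) D].
    - If the energy of [f_1n] did not vanish, then some threshold, found by
      pigeonhole on the distribution function of the central form, would
      separate it from the null hypothesis. So inconsistency forces the energy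
      of [f_1n] to tend to [0].
    - The central form does not concentrate: its characteristic function at
      [k] is [O(k^-2)], and a Fejer kernel turns this into
      [P(|S - x| <= 1/M) = O(1/M)] uniformly in [x]. So when [f_n] has bounded
      energy, the perturbation [f_1n] changes the type II error by [o(1)].
    - When [f_n] has large energy both type II errors are small, by Chebyshev.

    All estimates are proved for finite sums, uniformly in the number of
    terms, and passed to the limit on probabilities. *)
Require Import Defs.
From HB Require Import structures.
From mathcomp Require Import all_boot all_order all_algebra.
From mathcomp Require Import all_classical all_reals all_analysis.
From mathcomp Require Import measurable_realfun ring lra.
Import Order.TTheory GRing.Theory Num.Theory.
Import numFieldNormedType.Exports.
Local Open Scope classical_set_scope.
Local Open Scope ring_scope.

(** The normal law enters through the properties collected in [square_noise]. The decisive one is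
    that the square of each noise variable charges both [0, 1] and [4, 9] with mass at least [p]:
    this forces |E exp(i u X^2)|^2 <= 1 - p u^2 / 2 for u in [0, 1/9]. The product over j is then at
    most exp(- (p / 2) u^2 sum a_j^2), and the smallness of max a_j keeps the frequencies k a_j in
    range for all integers k below a fixed M. The obstacle in comparing h with h + g is the cross
    term 2 sum a_j h_j g_j, which a small energy of g controls only while the energy of h is
    bounded; hence the two regimes. For large energy of h, the positive level of the test keeps the
    threshold within a bounded distance to the right of the centre of the null law, and the signal
    carries the statistic beyond it. The rescaled threshold is an increasing affine function of the
    original one. Since inconsistency ranges over all thresholds, it can be tested at any real
    sequence, in particular at the one supplied by the pigeonhole argument. *)

(** * Independence of real random variables *)

Lemma finite_measure_prod_unique (d1 d2 : measure_display)
    (T1 : measurableType d1) (T2 : measurableType d2) (R : realType)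
    (m1 m2 : {measure set (T1 * T2) -> \bar R}) :
  (m1 setT < +oo)%E ->
  (forall A B, measurable A -> measurable B -> m1 (A `*` B) = m2 (A `*` B)) ->
  forall E, measurable E -> m1 E = m2 E.
Proof.
move=> m1T m12 E mE.
pose C : set (set (T1 * T2)) := [set A `*` B | A in measurable & B in measurable].
apply: (measure_unique C (fun=> setT)) => //.
- by rewrite /C -measurable_prod_measurableType.
- move=> _ _ [A1 mA1 [A2 mA2 <-]] [B1 mB1 [B2 mB2 <-]].
  rewrite -setXI; exists (A1 `&` B1); first exact: measurableI.
  by exists (A2 `&` B2) => //; exact: measurableI.
- by move=> _; exists setT => //; exists setT => //; rewrite setXTT.
- by rewrite bigcup_const.
- by move=> _ [A mA [B mB <-]]; exact: m12.
Qed.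

Definition mutually_independent {R : realType} {d : measure_display}
    {Omega : measurableType d} (P : probability Omega R)
    (X : nat -> Omega -> R) : Prop :=
  forall (J : seq nat) (B : nat -> set R), uniq J ->
    (forall j, measurable (B j)) ->
    P (\bigcap_(j in [set j | j \in J]) (X j @^-1` B j)) =
    (\prod_(j <- J) P (X j @^-1` B j))%E.

Definition independent2 {R : realType} {d : measure_display}
    {Omega : measurableType d} (P : probability Omega R)
    (U V : Omega -> R) : Prop :=
  forall A B : set R, measurable A -> measurable B ->
    P (U @^-1` A `&` V @^-1` B) = (P (U @^-1` A) * P (V @^-1` B))%E.

Section Independence.
Context {R : realType} {d : measure_display} {Omega : measurableType d}.
Variables (P : probability Omega R) (X : nat -> Omega -> R).
Hypothesis mX : forall j, measurable_fun setT (X j).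
Hypothesis iX : mutually_independent P X.

Lemma preimage_measurableT (U : Omega -> R) (A : set R) :
  measurable_fun setT U -> measurable A -> measurable (U @^-1` A).
Proof. by move=> mU mA; rewrite -[_ @^-1` _]setTI; exact: mU. Qed.

Lemma independent2_comp (U V : Omega -> R) (g h : R -> R) :
  measurable_fun setT g -> measurable_fun setT h ->
  independent2 P U V -> independent2 P (g \o U) (h \o V).
Proof.
move=> mg mh UV A B mA mB; apply: (UV (g @^-1` A) (h @^-1` B)).
- by rewrite -[_ @^-1` _]setTI; exact: mg.
- by rewrite -[_ @^-1` _]setTI; exact: mh.
Qed.

Let rest (J : seq nat) (B : nat -> set R) :=
  \bigcap_(j in [set j | j \in J]) (X j @^-1` B j).

Let measurable_rest J B : (forall j, measurable (B j)) -> measurable (rest J B).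
Proof.
move=> mB; rewrite /rest -[X in \bigcap_(j in X) _]/[set` J] bigcap_seq.
by apply: bigsetI_measurable => j _; exact: preimage_measurableT.
Qed.

Lemma mutually_independent2 i j : i != j -> independent2 P (X i) (X j).
Proof.
move=> ij A B mA mB.
pose C k := if k == i then A else B.
have ji : (j == i) = false by apply/negbTE; rewrite eq_sym.
have mC k : measurable (C k) by rewrite /C; case: ifP.
have uij : uniq [:: i; j] by rewrite /= inE ij.
have := iX [:: i; j] C uij mC.
rewrite !big_cons big_nil mule1 /C eqxx ji => <-.
congr (P _); apply/seteqP; split => [w [wA wB] k /=|w /= h].
  by rewrite !inE => /orP[]/eqP->; rewrite ?eqxx ?ji.
split.
  by have /= := h i; rewrite eqxx inE eqxx; apply.
by have /= := h j; rewrite ji !inE eqxx orbT; apply.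
Qed.

Variable g : nat -> R -> R.
Hypothesis mg : forall i, measurable_fun setT (g i).

Let S k w : R := \sum_(i < k) g i (X i w).

Let mS k : measurable_fun setT (S k).
Proof. by apply: measurable_sum => i; exact: measurableT_comp. Qed.

(** The induction needs more than the independence of [S k] and [X k]: [S k] is independent of every
    finite family of variables of index at least k. In the step, the law of the pair ([S k], [X k])
    restricted to the event [rest J B], and its unrestricted law multiplied by the probability of
    that event, are finite measures on the plane. They agree on rectangles, hence on the set [E]
    that encodes the next partial sum. *)
Let partial_sum_rest k : forall J B A, uniq J -> (forall j, measurable (B j)) ->
  (forall j, j \in J -> (k <= j)%N) -> measurable A ->
  P (S k @^-1` A `&` rest J B) = (P (S k @^-1` A) * P (rest J B))%E.
Proof.
elim: k => [|k IH] J B A uJ mB kJ mA.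
  have -> : S 0 = cst 0 by apply/funext => w; rewrite /S big_ord0.
  rewrite preimage_cst; case: ifP => _; first by rewrite setTI probability_setT mul1e.
  by rewrite set0I measure0 mul0e.
have mr := measurable_rest J B mB.
have mSX : measurable_fun setT (fun w => (S k w, X k w)) by exact: measurable_fun_pair.
pose c : {nonneg R} := NngNum (fine_ge0 (measure_ge0 P (rest J B))).
have cE : c%:num%:E = P (rest J B) by rewrite /= fineK// fin_num_measure.
pose E : set (R * R) := (fun z => z.1 + g k z.2) @^-1` A.
have mE : measurable E.
  rewrite /E -[_ @^-1` _]setTI.
  suff : measurable_fun setT (fun z : R * R => z.1 + g k z.2) by exact.
  apply: measurable_funD; first exact: measurable_fst.
  by apply: measurableT_comp => //; exact: measurable_snd.
have SE : S k.+1 @^-1` A = (fun w => (S k w, X k w)) @^-1` E.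
  by apply/seteqP; split => w; rewrite /E /S /= big_ord_recr.
have key A0 B0 J0 : measurable A0 -> measurable B0 -> uniq J0 ->
    (forall j, j \in J0 -> (k < j)%N) ->
    P ((fun w => (S k w, X k w)) @^-1` (A0 `*` B0) `&` rest J0 B) =
    (P (S k @^-1` A0) * P (X k @^-1` B0) * P (rest J0 B))%E.
  move=> mA0 mB0 uJ0 kJ0.
  pose C j := if j == k then B0 else B j.
  have mC j : measurable (C j) by rewrite /C; case: ifP.
  have kJ0' : k \notin J0 by apply/negP => /kJ0; rewrite ltnn.
  have ukJ0 : uniq (k :: J0) by rewrite /= kJ0'.
  have CB j : j \in J0 -> C j = B j.
    by rewrite /C; case: eqP => // -> /kJ0; rewrite ltnn.
  have restC : rest (k :: J0) C = X k @^-1` B0 `&` rest J0 B.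
    apply/seteqP; split => w.
      move=> h; split.
        by have /= := h k; rewrite /C eqxx inE eqxx; apply.
      by move=> j /= jJ; have /= := h j; rewrite CB// inE jJ orbT; apply.
    move=> [wB h] j /=; rewrite inE => /predU1P[->|jJ]; first by rewrite /C eqxx.
    by rewrite CB//; exact: h.
  have := IH (k :: J0) C A0 ukJ0 mC _ mA0; rewrite restC setIA.
  have -> : S k @^-1` A0 `&` X k @^-1` B0 =
            (fun w => (S k w, X k w)) @^-1` (A0 `*` B0) by [].
  move=> ->; last by move=> j; rewrite inE => /predU1P[->//|/kJ0/ltnW].
  rewrite -muleA -restC; congr (_ * _)%E.
  rewrite [LHS]iX// [X in (_ * X)%E]iX// big_cons {1}/C eqxx; congr (_ * _)%E.
  by apply: eq_big_seq => j jJ; rewrite CB.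
have := @finite_measure_prod_unique _ _ _ _ R
  (pushforward (mrestr P mr) (fun w => (S k w, X k w)))
  (mscale c (pushforward P (fun w => (S k w, X k w)))) => /(_ mSX mSX).
move=> h.
suff h2 : (P ((fun w => (S k w, X k w)) @^-1` E `&` rest J B) =
    c%:num%:E * P ((fun w => (S k w, X k w)) @^-1` E))%E.
  by rewrite SE h2 cE muleC.
apply: h => //.
- change (P (setT `&` rest J B) < +oo)%E; rewrite setTI.
  by apply: le_lt_trans (ltry 1); exact: probability_le1.
- move=> A0 B0 mA0 mB0.
  change (P ((fun w => (S k w, X k w)) @^-1` (A0 `*` B0) `&` rest J B) =
    c%:num%:E * P ((fun w => (S k w, X k w)) @^-1` (A0 `*` B0)))%E.
  rewrite cE key//.
  (* With no further variable, [key] factors the unrestricted law of the pair. *)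
  have := key A0 B0 [::] mA0 mB0 isT.
  rewrite /rest (_ : [set j | j \in [::]] = set0) ?bigcap_set0 ?setIT; last first.
    by apply/seteqP; split.
  by rewrite probability_setT mule1 => ->// ; rewrite muleC.
Qed.

Lemma partial_sum_independent2 k : independent2 P (S k) (X k).
Proof.
move=> A B mA mB.
have := @partial_sum_rest k [:: k] (fun=> B) A isT (fun=> mB) _ mA.
have -> : rest [:: k] (fun=> B) = X k @^-1` B.
  apply/seteqP; split => w; first by apply; rewrite /= inE.
  by move=> wB j /=; rewrite inE => /eqP->.
by apply => j; rewrite inE => /eqP->.
Qed.

End Independence.

(** * Expectations and products of independent variables *)

Section Expectation.
Context {R : realType} {d : measure_display} {Omega : measurableType d}.
Variable P : probability Omega R.
Local Notation ig f := (P.-integrable setT (EFin \o f)).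
Local Notation E f := (Rintegral P setT f).

Lemma bounded_integrable (f : Omega -> R) (M : R) :
  measurable_fun setT f -> (forall w, `|f w| <= M) -> ig f.
Proof.
move=> mf fM; apply: measurable_bounded_integrable => //.
  by apply: le_lt_trans (ltry 1); exact: probability_le1.
by exists M; split => [|x Mx w _ /=]; rewrite ?num_real// (le_trans (fM w))// ltW.
Qed.

Lemma integrableD_fun (f g : Omega -> R) : ig f -> ig g -> ig (fun w => f w + g w).
Proof. by move=> iF iG; exact: (integrableD _ iF iG). Qed.

Lemma integrableB_fun (f g : Omega -> R) : ig f -> ig g -> ig (fun w => f w - g w).
Proof. by move=> iF iG; exact: (integrableB _ iF iG). Qed.

Lemma integrableZl_fun (c : R) (f : Omega -> R) : ig f -> ig (fun w => c * f w).
Proof. by move=> iF; exact: (integrableZl _ c iF). Qed.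

Lemma integrable_cst_fun (c : R) : ig (fun=> c).
Proof. exact: finite_measure_integrable_cst. Qed.

Lemma integrable_sum_fun (k : nat) (f : nat -> Omega -> R) :
  (forall i, (i < k)%N -> ig (f i)) -> ig (fun w => \sum_(i < k) f i w).
Proof.
elim: k => [|k IH] iF.
  have -> : (fun w => \sum_(i < 0) f i w) = (fun=> 0).
    by apply/funext => w; rewrite big_ord0.
  exact: integrable_cst_fun.
have -> : (fun w => \sum_(i < k.+1) f i w) =
          (fun w => (\sum_(i < k) f i w) + f k w).
  by apply/funext => w; rewrite big_ord_recr.
by apply: integrableD_fun; [apply: IH => i ik; exact: (iF _ (ltnW ik))|exact: iF].
Qed.

Lemma expectation_sum_fun (k : nat) (f : nat -> Omega -> R) :
  (forall i, (i < k)%N -> ig (f i)) ->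
  E (fun w => \sum_(i < k) f i w) = \sum_(i < k) E (f i).
Proof.
elim: k => [|k IH] iF.
  rewrite big_ord0 -[RHS](mul0r (fine (P setT))) -Rintegral_cst//.
  by apply: eq_Rintegral => w _; rewrite big_ord0.
rewrite big_ord_recr /= -IH; last by move=> i ik; exact: (iF _ (ltnW ik)).
rewrite -RintegralD//.
- by apply: eq_Rintegral => w _; rewrite big_ord_recr.
- by apply: integrable_sum_fun => i ik; exact: (iF _ (ltnW ik)).
- exact: iF.
Qed.

Lemma expectation_cst_fun (c : R) : E (fun=> c) = c.
Proof.
rewrite Rintegral_cst// [X in _ * fine X](_ : _ = 1%E) ?mulr1//.
exact: probability_setT.
Qed.

Lemma prob_le_expectation (f : Omega -> R) (A : set Omega) (c : R) :
  measurable A -> ig f -> (forall w, 0 <= f w) -> (forall w, A w -> c <= f w) ->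
  c * fine (P A) <= E f.
Proof.
move=> mA iF f0 fA.
have iA : ig (\1_A : Omega -> R).
  apply: (bounded_integrable _ 1) => // w; rewrite ger0_norm indicE//.
  by case: (w \in A).
have -> : fine (P A) = E (\1_A : Omega -> R).
  by rewrite /Rintegral integral_indic// setIT.
rewrite -RintegralZl//; apply: le_Rintegral => //; first exact: integrableZl_fun.
move=> w _; change (c * \1_A w <= f w); rewrite indicE.
case: (boolP (w \in A)) => wA /=.
  by rewrite mulr1; apply: fA; rewrite inE in wA.
by rewrite mulr0.
Qed.

(** Independence makes the joint law agree with the product of the marginal laws on rectangles,
    hence everywhere. Integrability of the product then comes from Tonelli and the factorisation
    from Fubini. *)
Lemma independent2_expectationM (U V : Omega -> R) :
  measurable_fun setT U -> measurable_fun setT V -> independent2 P U V ->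
  ig U -> ig V -> ig (fun w => U w * V w) /\ E (fun w => U w * V w) = E U * E V.
Proof.
move=> mU mV UV iU iV.
pose U' : {mfun Omega >-> R} := HB.pack U (isMeasurableFun.Build _ _ _ _ _ mU).
pose V' : {mfun Omega >-> R} := HB.pack V (isMeasurableFun.Build _ _ _ _ _ mV).
pose m1 : probability R R := distribution P U'.
pose m2 : probability R R := distribution P V'.
pose W w := (U w, V w).
have mW : measurable_fun setT W by exact: measurable_fun_pair.
pose f (z : R * R) : \bar R := (z.1 * z.2)%:E.
have mf : measurable_fun setT f.
  apply/measurable_EFinP; apply: measurable_funM; [exact: measurable_fst|exact: measurable_snd].
have prodE X : measurable X -> (m1 \x m2)%E X = pushforward P W X.
  move=> mX; have := @product_measure_unique _ _ _ _ R m1 m2 (pushforward P W).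
  move=> /(_ mW) h; apply: h => // A B mA mB; exact: UV.
have mid : measurable_fun setT (EFin : R -> \bar R) by exact/measurable_EFinP.
have i1 : m1.-integrable setT (EFin : R -> \bar R).
  exact: (@integrable_pushforward _ _ _ _ _ _ mU P setT EFin mid iU).
have i2 : m2.-integrable setT (EFin : R -> \bar R).
  exact: (@integrable_pushforward _ _ _ _ _ _ mV P setT EFin mid iV).
have E1 : (\int[m1]_x x%:E)%E = (E U)%:E.
  rewrite (@integral_pushforward _ _ _ _ _ _ mU P setT EFin mid iU)// fineK//.
  exact: integrable_fin_num.
have E2 : (\int[m2]_x x%:E)%E = (E V)%:E.
  rewrite (@integral_pushforward _ _ _ _ _ _ mV P setT EFin mid iV)// fineK//.
  exact: integrable_fin_num.
have if12 : (m1 \x m2)%E.-integrable setT f.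
  apply/integrable12ltyP => //.
  have -> : (\int[m1]_x \int[m2]_y `|f (x, y)|)%E =
            (\int[m1]_x (`|x%:E| * \int[m2]_y `|y%:E|))%E.
    apply: eq_integral => x _; rewrite -ge0_integralZl//; last first.
      exact: measurableT_comp.
    by apply: eq_integral => y _; rewrite /f /= normrM EFinM.
  have /integrableP[_ h1] := i1; have /integrableP[_ h2] := i2.
  have h2f : (\int[m2]_y `|y%:E|)%E \is a fin_num.
    by rewrite ge0_fin_numE//; exact: integral_ge0.
  rewrite -(fineK h2f) ge0_integralZr//; last 2 first.
  - exact: measurableT_comp.
  - by rewrite lee_fin fine_ge0//; exact: integral_ge0.
  have h1f : (\int[m1]_y `|y%:E|)%E \is a fin_num.
    by rewrite ge0_fin_numE//; exact: integral_ge0.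
  by rewrite -(fineK h1f) -EFinM ltry.
have if' : (pushforward P W).-integrable setT f.
  have /integrableP[_ h] := if12; apply/integrableP; split => //.
  apply: le_lt_trans h; rewrite le_eqVlt; apply/orP; left; apply/eqP/esym.
  by apply: eq_measure_integral => A mA _; exact: prodE.
have iP : ig (fun w => U w * V w).
  apply/integrableP; split.
    by apply/measurable_EFinP; exact: measurable_funM.
  have /integrableP[_] := if'; rewrite ge0_integral_pushforward//.
  exact: measurableT_comp.
split=> //.
have : (\int[P]_w (U w * V w)%:E = (E U)%:E * (E V)%:E)%E.
  have := @integral_pushforward _ _ _ _ _ _ mW P setT f mf iP measurableT.
  rewrite preimage_setT => <-.
  transitivity (\int[(m1 \x m2)%E]_z f z)%E.
    by apply: eq_measure_integral => A mA _; exact/esym/prodE.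
  rewrite -integral12_prod_meas1// -E1 -E2.
  transitivity (\int[m1]_x (x%:E * \int[m2]_y y%:E))%E.
    apply: eq_integral => x _; rewrite -integralZl//.
  by rewrite E2 integralZr.
by rewrite /Rintegral => ->.
Qed.

End Expectation.

(** * Trigonometric bounds and the Fejer kernel *)

Section Trigonometry.
Context {R : realType}.
Implicit Types x y z u : R.

Lemma norm_sin_le x : `|sin x| <= `|x|.
Proof.
wlog x0 : x / 0 <= x.
  move=> h; have [/h//|x0] := leP 0 x.
  by rewrite -(normrN x) -(normrN (sin x)) -sinN; apply: h; rewrite oppr_ge0 ltW.
have [c _] := MVT_segment x0 (fun y _ => is_derive_sin y)
  (continuous_subspaceT (@continuous_sin R)).
by rewrite sin0 !subr0 => ->; rewrite normrM ler_piMl// cos_max.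
Qed.

Lemma cosE_sin_half x : cos x = 1 - 2 * sin (x / 2) ^+ 2.
Proof.
have {1}-> : x = x / 2 + x / 2 by lra.
by rewrite cosD; have := cos2Dsin2 (x / 2); nra.
Qed.

Lemma cos_ge x : 1 - x ^+ 2 / 2 <= cos x.
Proof.
rewrite cosE_sin_half; have := norm_sin_le (x / 2).
rewrite -(ler_pXn2r (ltn0Sn 1)) ?nnegrE// !real_normK ?num_real// => h.
by rewrite lerD2l lerN2; nra.
Qed.

Lemma sin_ge x : 0 <= x <= 1 -> x / 2 <= sin x.
Proof.
move=> /andP[x0 x1].
have [c] := MVT_segment x0 (fun y _ => is_derive_sin y)
  (continuous_subspaceT (@continuous_sin R)).
rewrite in_itv /= => /andP[c0 cx]; rewrite sin0 !subr0 => ->.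
by have := cos_ge c; nra.
Qed.

Lemma one_sub_cos_ge x : 0 <= x <= 1 -> x ^+ 2 / 8 <= 1 - cos x.
Proof.
move=> /andP[x0 x1]; rewrite cosE_sin_half.
have : x / 2 / 2 <= sin (x / 2) by apply: sin_ge; lra.
by move=> h; nra.
Qed.

Lemma measurable_cos_fun : measurable_fun setT (@cos R).
Proof. by apply: continuous_measurable_fun; exact: continuous_cos. Qed.

Lemma measurable_sin_fun : measurable_fun setT (@sin R).
Proof. by apply: continuous_measurable_fun; exact: continuous_sin. Qed.

(* The squared modulus of the Dirichlet sum [\sum_(m < M) exp (i m y)]. *)
Definition fejer (M : nat) y : R :=
  (\sum_(m < M) cos (m%:R * y)) ^+ 2 + (\sum_(m < M) sin (m%:R * y)) ^+ 2.

Lemma fejer_ge0 M y : 0 <= fejer M y.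
Proof. by rewrite addr_ge0// sqr_ge0. Qed.

Lemma cos_distn (m n : nat) y :
  cos (`|m - n|%N%:R * y) = cos ((m%:R - n%:R) * y).
Proof.
have [mn|nm] := leqP m n.
  rewrite distnEr// natrB// -cosN; congr cos; ring.
by rewrite distnEl ?natrB// ltnW.
Qed.

(** Expanding the squares leaves only differences of indices, so the expectation of the kernel
    involves characteristic functions at integers below [M] only. *)
Lemma fejerE M y :
  fejer M y = \sum_(m < M) \sum_(n < M) cos (`|m - n|%N%:R * y).
Proof.
rewrite /fejer !expr2 !big_distrl /= -big_split /=; apply: eq_bigr => m _.
rewrite !big_distrr /= -big_split /=; apply: eq_bigr => n _.
by rewrite cos_distn mulrBl cosB.
Qed.

(** All angles m y with m < M lie in [-1, 1], where the cosine is at least 1/2. *)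
Lemma fejer_ge M y : M%:R * `|y| <= 1 -> M%:R ^+ 2 / 4 <= fejer M y.
Proof.
move=> My; rewrite /fejer.
have h : M%:R / 2 <= \sum_(m < M) cos (m%:R * y).
  have -> : M%:R / 2 = \sum_(m < M) (2^-1 : R).
    by rewrite sumr_const card_ord mulr_natl.
  apply: ler_sum => m _; apply: le_trans (cos_ge _).
  have : `|m%:R * y| <= 1.
    rewrite normrM normr_nat; apply: le_trans My.
    by rewrite ler_wpM2r// ler_nat ltnW.
  rewrite -(ler_pXn2r (ltn0Sn 1)) ?nnegrE// real_normK ?num_real// expr1n.
  by lra.
have := sqr_ge0 (\sum_(m < M) sin (m%:R * y)).
have : 0 <= M%:R / 2 :> R by rewrite divr_ge0.
by move: h; nra.
Qed.

(** In the row of a fixed m, each value of |m - n| occurs at most twice, once on each side of the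
    diagonal. *)
Lemma sum_distn_le (M : nat) (r : nat -> R) : (forall k, 0 <= r k) ->
  \sum_(m < M) \sum_(n < M) r `|m - n|%N <= M%:R * (2 * \sum_(k < M) r k).
Proof.
move=> r0.
have mono a b : (a <= b)%N -> \sum_(0 <= k < a) r k <= \sum_(0 <= k < b) r k.
  move=> ab; rewrite (big_cat_nat (leq0n a) ab) /= lerDl.
  by apply: sumr_ge0 => k _.
have -> : M%:R * (2 * \sum_(k < M) r k) = \sum_(m < M) (2 * \sum_(k < M) r k).
  by rewrite sumr_const card_ord mulr_natl.
apply: ler_sum => m _; rewrite mulr_natl mulr2n.
rewrite -(big_mkord xpredT (fun n => r `|m - n|%N)) -(big_mkord xpredT r).
rewrite (big_cat_nat (leq0n m) (ltnW (ltn_ord m))) /=; apply: lerD.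
  rewrite big_nat_rev /=.
  have -> : \sum_(0 <= n < m) r `|m - (0 + m - n.+1)|%N = \sum_(0 <= n < m) r n.+1.
    apply: eq_big_nat => n /andP[_ nm]; congr r.
    by rewrite add0n distnEl ?leq_subr// subKn.
  apply: le_trans (mono m.+1 M (ltn_ord m)).
  by rewrite big_nat_recl//= lerDr.
rewrite -{1}(add0n (m : nat)) big_addn.
apply: le_trans (mono (M - m)%N M (leq_subr _ _)).
rewrite le_eqVlt; apply/orP; left; apply/eqP; apply: eq_big_nat => n _.
by congr r; rewrite distnEr ?leq_addl// addnK.
Qed.

(** Telescoping, from C / (a + 1)^2 <= C / a - C / (a + 1). The term at 0 stands for the frequency
    0, where a characteristic function equals 1. *)
Lemma sum_inv_sqr_le (C : R) (M : nat) : 0 <= C ->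
  \sum_(k < M) (if k == 0%N :> nat then 1 else C / k%:R ^+ 2) <= 1 + 2 * C.
Proof.
move=> C0; pose r k : R := if k == 0%N then 1 else C / k%:R ^+ 2.
have r0 k : 0 <= r k by rewrite /r; case: eqP => // _; rewrite divr_ge0// exprn_ge0.
have h (N : nat) : \sum_(k < N.+2) r k <= 1 + 2 * C - C / N.+1%:R.
  elim: N => [|N IH].
    by rewrite !big_ord_recr big_ord0 /r /= expr1n divr1; lra.
  rewrite big_ord_recr /=; apply: le_trans (lerD IH (lexx _)) _.
  rewrite /r /=; set a : R := N.+1%:R.
  have a0 : 0 < a by rewrite ltr0n.
  have -> : N.+2%:R = a + 1 :> R by rewrite /a -natr1.
  have : C / (a + 1) ^+ 2 <= C / a - C / (a + 1); last first.
    by set u := C / (a + 1); set v := C / (a + 1) ^+ 2; set w := C / a; lra.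
  have -> : C / a - C / (a + 1) = C / (a * (a + 1)).
    by field; rewrite !gt_eqF//; lra.
  rewrite ler_wpM2l// lef_pV2 ?posrE ?mulr_gt0 ?exprn_gt0//; nra.
apply: (@le_trans _ _ (\sum_(k < M.+2) r k)).
  by rewrite !big_ord_recr /=; have := r0 M; have := r0 M.+1; lra.
apply: le_trans (h M) _; have : 0 <= C / M.+1%:R by rewrite divr_ge0.
by set u := C / _; lra.
Qed.

End Trigonometry.

(** * Characteristic functions and anticoncentration *)

Section CharacteristicFunction.
Context {R : realType} {d : measure_display} {Omega : measurableType d}.
Variable P : probability Omega R.
Local Notation ig f := (P.-integrable setT (EFin \o f)).
Local Notation E f := (Rintegral P setT f).
Implicit Types Z U V : Omega -> R.

(* The squared modulus of the characteristic function of [Z]. *)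
Definition cf2 Z (u : R) : R :=
  E (fun w => cos (u * Z w)) ^+ 2 + E (fun w => sin (u * Z w)) ^+ 2.

Lemma cf2_ge0 Z u : 0 <= cf2 Z u.
Proof. by rewrite addr_ge0// sqr_ge0. Qed.

Lemma measurable_cosM Z u : measurable_fun setT Z ->
  measurable_fun setT (fun w => cos (u * Z w)).
Proof.
move=> mZ; apply: (measurableT_comp measurable_cos_fun).
exact: measurable_funM.
Qed.

Lemma measurable_sinM Z u : measurable_fun setT Z ->
  measurable_fun setT (fun w => sin (u * Z w)).
Proof.
move=> mZ; apply: (measurableT_comp measurable_sin_fun).
exact: measurable_funM.
Qed.

Lemma integrable_cosM Z u : measurable_fun setT Z -> ig (fun w => cos (u * Z w)).
Proof.
move=> mZ; apply: (bounded_integrable _ _ 1); first exact: measurable_cosM.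
by move=> w; exact: cos_max.
Qed.

Lemma integrable_sinM Z u : measurable_fun setT Z -> ig (fun w => sin (u * Z w)).
Proof.
move=> mZ; apply: (bounded_integrable _ _ 1); first exact: measurable_sinM.
by move=> w; exact: sin_max.
Qed.

Lemma cf2_add U V u : measurable_fun setT U -> measurable_fun setT V ->
  independent2 P U V -> cf2 (fun w => U w + V w) u = cf2 U u * cf2 V u.
Proof.
move=> mU mV UV.
have mc : measurable_fun setT (fun x : R => cos (u * x)).
  by apply: (measurableT_comp measurable_cos_fun); exact: measurable_funM.
have ms : measurable_fun setT (fun x : R => sin (u * x)).
  by apply: (measurableT_comp measurable_sin_fun); exact: measurable_funM.
have [icc Ecc] := independent2_expectationM _ _ _
  (measurable_cosM _ u mU) (measurable_cosM _ u mV)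
  (independent2_comp _ _ _ _ _ mc mc UV) (integrable_cosM _ u mU) (integrable_cosM _ u mV).
have [iss Ess] := independent2_expectationM _ _ _
  (measurable_sinM _ u mU) (measurable_sinM _ u mV)
  (independent2_comp _ _ _ _ _ ms ms UV) (integrable_sinM _ u mU) (integrable_sinM _ u mV).
have [isc Esc] := independent2_expectationM _ _ _
  (measurable_sinM _ u mU) (measurable_cosM _ u mV)
  (independent2_comp _ _ _ _ _ ms mc UV) (integrable_sinM _ u mU) (integrable_cosM _ u mV).
have [ics Ecs] := independent2_expectationM _ _ _
  (measurable_cosM _ u mU) (measurable_sinM _ u mV)
  (independent2_comp _ _ _ _ _ mc ms UV) (integrable_cosM _ u mU) (integrable_sinM _ u mV).
have EC : E (fun w => cos (u * (U w + V w))) =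
    E (fun w => cos (u * U w) * cos (u * V w)) -
    E (fun w => sin (u * U w) * sin (u * V w)).
  by rewrite -RintegralB//; apply: eq_Rintegral => w _; rewrite mulrDr cosD.
have ES : E (fun w => sin (u * (U w + V w))) =
    E (fun w => sin (u * U w) * cos (u * V w)) +
    E (fun w => cos (u * U w) * sin (u * V w)).
  by rewrite -RintegralD//; apply: eq_Rintegral => w _; rewrite mulrDr sinD.
by rewrite /cf2 EC ES Ecc Ess Esc Ecs; ring.
Qed.

(** The expectation is the real part of exp(-i u x) E exp(i u Z), hence at most the modulus of the
    second factor. The proof uses the Lagrange identity in the plane. *)
Lemma expectation_cos_shift_le Z (u x c : R) : measurable_fun setT Z ->
  0 <= c -> cf2 Z u <= c ^+ 2 -> E (fun w => cos (u * (Z w - x))) <= c.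
Proof.
move=> mZ c0 Zc.
have ic := integrable_cosM _ u mZ; have is_ := integrable_sinM _ u mZ.
have -> : E (fun w => cos (u * (Z w - x))) =
    cos (u * x) * E (fun w => cos (u * Z w)) +
    sin (u * x) * E (fun w => sin (u * Z w)).
  rewrite -!RintegralZl// -RintegralD//; last 2 first.
  - exact: integrableZl_fun.
  - exact: integrableZl_fun.
  by apply: eq_Rintegral => w _; rewrite mulrBr cosB mulrC; congr (_ + _); rewrite mulrC.
move: Zc; rewrite /cf2; move: (E _) (E _) => q p h.
have cs := cos2Dsin2 (u * x); move: cs; move: (cos _) (sin _) => s t cs.
rewrite leNgt; apply/negP => lt.
have : c ^+ 2 < (s * p + t * q) ^+ 2.
  by rewrite ltr_pXn2r ?nnegrE// (le_trans c0 (ltW lt)).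
have -> : (s * p + t * q) ^+ 2 =
    (s ^+ 2 + t ^+ 2) * (p ^+ 2 + q ^+ 2) - (s * q - t * p) ^+ 2 by ring.
by have := sqr_ge0 (s * q - t * p); rewrite cs mul1r; lra.
Qed.

(** The kernel at Z - x is nonnegative and at least M^2 / 4 on the event, so the probability is at
    most 4 / M^2 times its expectation. That expectation is a double sum of terms at most 1 on the
    diagonal and C / k^2 at distance k from it, in total at most 2 M (1 + 2 C). *)
Lemma anticoncentration Z (C : R) (M : nat) : measurable_fun setT Z ->
  0 <= C -> (0 < M)%N ->
  (forall k, (0 < k < M)%N -> cf2 Z k%:R <= (C / k%:R ^+ 2) ^+ 2) ->
  forall x, fine (P [set w | `|Z w - x| <= M%:R^-1]) <= 8 * (1 + 2 * C) / M%:R.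
Proof.
move=> mZ C0 M0 hC x.
have M0' : 0 < M%:R :> R by rewrite ltr0n.
have mZx : measurable_fun setT (fun w => Z w - x) by exact: measurable_funB.
pose r k : R := if k == 0%N then 1 else C / k%:R ^+ 2.
have r0 k : 0 <= r k by rewrite /r; case: eqP => // _; rewrite divr_ge0// exprn_ge0.
have FE : (fun w => fejer M (Z w - x)) = (fun w => \sum_(m < M) \sum_(n < M)
     cos (`|m - n|%N%:R * (Z w - x))) by apply/funext => w; rewrite fejerE.
have iF1 (m : nat) : ig (fun w => \sum_(n < M) cos (`|m - n|%N%:R * (Z w - x))).
  apply: (integrable_sum_fun _ _ (fun n w => cos (`|m - n|%N%:R * (Z w - x)))).
  by move=> n _; exact: integrable_cosM.
have iF : ig (fun w => fejer M (Z w - x)).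
  rewrite FE; apply: (integrable_sum_fun _ _
     (fun m w => \sum_(n < M) cos (`|m - n|%N%:R * (Z w - x)))) => m _.
  exact: iF1.
have mA : measurable [set w | `|Z w - x| <= M%:R^-1].
  have -> : [set w | `|Z w - x| <= M%:R^-1] =
      (fun w => `|Z w - x|) @^-1` `]-oo, M%:R^-1].
    by apply/seteqP; split => w /=; rewrite in_itv.
  apply: preimage_measurableT => //.
  exact: measurableT_comp.
have low := prob_le_expectation _ _ _ (M%:R ^+ 2 / 4) mA iF (fun w => fejer_ge0 M _).
have {}low : M%:R ^+ 2 / 4 * fine (P [set w | `|Z w - x| <= M%:R^-1]) <=
    E (fun w => fejer M (Z w - x)).
  apply: low => w /= h; apply: fejer_ge.
  by rewrite -ler_pdivlMl// mulr1.
have up : E (fun w => fejer M (Z w - x)) <= M%:R * (2 * (1 + 2 * C)).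
  rewrite FE (expectation_sum_fun _ _
     (fun m w => \sum_(n < M) cos (`|m - n|%N%:R * (Z w - x)))) => [|m _]; last exact: iF1.
  apply: (@le_trans _ _ (\sum_(m < M) \sum_(n < M) r `|m - n|%N)).
    apply: ler_sum => m _.
    rewrite (expectation_sum_fun _ _ (fun n w => cos (`|m - n|%N%:R * (Z w - x)))); last first.
      by move=> n _; exact: integrable_cosM.
    apply: ler_sum => n _; apply: expectation_cos_shift_le => //.
    rewrite /r; case: eqP => [->|/eqP k0].
      rewrite /cf2.
      have -> : E (fun w => cos (0%:R * Z w)) = 1.
        rewrite -[RHS](expectation_cst_fun P); apply: eq_Rintegral => w _.
        by rewrite mul0r cos0.
      have -> : E (fun w => sin (0%:R * Z w)) = 0; last by rewrite expr0n addr0.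
      rewrite -[RHS](expectation_cst_fun P); apply: eq_Rintegral => w _.
      by rewrite mul0r sin0.
    apply: hC; rewrite lt0n k0 /=.
    have [mn|nm] := leqP m n.
      by rewrite distnEr// (leq_ltn_trans (leq_subr _ _)).
    by rewrite distnEl ?(ltnW nm)// (leq_ltn_trans (leq_subr _ _)).
  apply: le_trans (sum_distn_le _ _ r0) _.
  rewrite ler_pM2l// ler_pM2l//; exact: sum_inv_sqr_le.
rewrite ler_pdivlMr//.
have := le_trans low up; move: (fine _) => p.
rewrite -[M%:R ^+ 2 / 4 * p]/(M%:R ^+ 2 / 4 * p) => h.
have : M%:R * (M%:R / 4 * p) <= M%:R * (2 * (1 + 2 * C)) by move: h; congr (_ <= _); ring.
by rewrite ler_pM2l//; nra.
Qed.

(* Whatever the centre [z], the points [exp (i u y)] with [y] in [0, 1] and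
   those with [y] in [4, 9] cannot both lie within [u / sqrt 2] of [z]. *)
Lemma cf2_two_sets Z (p u : R) : measurable_fun setT Z -> 0 <= u <= 9^-1 ->
  p <= fine (P [set w | 0 <= Z w <= 1]) -> p <= fine (P [set w | 4 <= Z w <= 9]) ->
  cf2 Z u <= 1 - p / 2 * u ^+ 2.
Proof.
move=> mZ u01 pA pB.
have ic := integrable_cosM _ u mZ; have is_ := integrable_sinM _ u mZ.
have mI (a b : R) : measurable [set w | a <= Z w <= b].
  have -> : [set w | a <= Z w <= b] = Z @^-1` `[a, b].
    by apply/seteqP; split => w /=; rewrite in_itv.
  exact: preimage_measurableT.
(* The centre is the mean of exp(i u Z), and [f] the squared distance to it; so E f(Z) is the
   variance 1 - [cf2 Z u]. *)
pose a := E (fun w => cos (u * Z w)); pose b := E (fun w => sin (u * Z w)).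
pose f y := (cos (u * y) - a) ^+ 2 + (sin (u * y) - b) ^+ 2.
have fE y : f y = (1 + a ^+ 2 + b ^+ 2) - (2 * a * cos (u * y) + 2 * b * sin (u * y)).
  by rewrite /f; have := cos2Dsin2 (u * y); nra.
have ifZ : ig (fun w => f (Z w)).
  have -> : (fun w => f (Z w)) = (fun w => (1 + a ^+ 2 + b ^+ 2) -
      (2 * a * cos (u * Z w) + 2 * b * sin (u * Z w))).
    by apply/funext => w; rewrite fE.
  apply: integrableB_fun; first exact: integrable_cst_fun.
  by apply: integrableD_fun; exact: integrableZl_fun.
have EfZ : E (fun w => f (Z w)) = 1 - cf2 Z u.
  transitivity (E (fun w => (1 + a ^+ 2 + b ^+ 2) -
      (2 * a * cos (u * Z w) + 2 * b * sin (u * Z w)))).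
    by apply: eq_Rintegral => w _; rewrite fE.
  rewrite RintegralB//; last 2 first.
  - exact: integrable_cst_fun.
  - by apply: integrableD_fun; exact: integrableZl_fun.
  rewrite expectation_cst_fun RintegralD//; last 2 first.
  - exact: integrableZl_fun.
  - exact: integrableZl_fun.
  rewrite !RintegralZl// /cf2 -/a -/b; ring.
have f0 y : 0 <= f y by rewrite addr_ge0// sqr_ge0.
(* Here y' - y lies in [3, 9]: u <= 1/9 keeps u (y' - y) in [0, 1], and 9 absorbs the factor 8. The
   two squared distances are then compared by the parallelogram identity. *)
have sep y y' : 0 <= y <= 1 -> 4 <= y' <= 9 -> u ^+ 2 <= f y + f y'.
  move=> h h'.
  have : (u * (y' - y)) ^+ 2 / 8 <= 1 - cos (u * (y' - y)).
    by apply: one_sub_cos_ge; nra.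
  have : u ^+ 2 <= (u * (y' - y)) ^+ 2 / 8.
    have : 9 <= (y' - y) ^+ 2 by nra.
    by rewrite exprMn; have := sqr_ge0 u; nra.
  rewrite mulrBr cosB /f.
  have := cos2Dsin2 (u * y); have := cos2Dsin2 (u * y').
  move: (cos (u * y)) (sin (u * y)) (cos (u * y')) (sin (u * y')) => s t s' t'.
  have := sqr_ge0 (s + s' - 2 * a); have := sqr_ge0 (t + t' - 2 * b).
  by lra.
have p2 : p * (u ^+ 2 / 2) <= E (fun w => f (Z w)).
  have u20 : 0 <= u ^+ 2 / 2 by rewrite divr_ge0// sqr_ge0.
  (* Either every point of [0, 1] is far from the centre, or one is close and [sep] makes all of
     [4, 9] far. *)
  have [hA|/existsNP[y /not_implyP[hy /negP]]] :=
      pselect (forall y, 0 <= y <= 1 -> u ^+ 2 / 2 <= f y).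
    have := prob_le_expectation _ _ _ (u ^+ 2 / 2) (mI 0 1) ifZ (fun w => f0 _) (fun w => hA _).
    by apply: le_trans; rewrite mulrC ler_wpM2l.
  rewrite -ltNge => fy.
  have hB w : 4 <= Z w <= 9 -> u ^+ 2 / 2 <= f (Z w).
    by move=> hw; have := sep _ _ hy hw; lra.
  have := prob_le_expectation _ _ _ (u ^+ 2 / 2) (mI 4 9) ifZ (fun w => f0 _) hB.
  by apply: le_trans; rewrite mulrC ler_wpM2l.
by move: p2; rewrite EfZ; lra.
Qed.

End CharacteristicFunction.

(** * Chebyshev bounds for uncorrelated sums *)

Section UncorrelatedSums.
Context {R : realType} {d : measure_display} {Omega : measurableType d}.
Variable P : probability Omega R.
Local Notation ig f := (P.-integrable setT (EFin \o f)).
Local Notation E f := (Rintegral P setT f).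
Variables (Z : nat -> Omega -> R) (v : R).
Hypothesis mZ : forall i, measurable_fun setT (Z i).
Hypothesis iZ : forall i j, ig (fun w => Z i w * Z j w).
Hypothesis EZ : forall i j, E (fun w => Z i w * Z j w) = if i == j then v else 0.

Lemma uncorrelated_variance (b : nat -> R) (J : nat) :
  ig (fun w => (\sum_(j < J) b j * Z j w) ^+ 2) /\
  E (fun w => (\sum_(j < J) b j * Z j w) ^+ 2) = v * \sum_(j < J) b j ^+ 2.
Proof.
have sqE : (fun w => (\sum_(j < J) b j * Z j w) ^+ 2) =
    (fun w => \sum_(i < J) \sum_(j < J) b i * b j * (Z i w * Z j w)).
  apply/funext => w; rewrite expr2 big_distrl /=; apply: eq_bigr => i _.
  by rewrite big_distrr /=; apply: eq_bigr => j _; ring.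
have i2 (i j : nat) : ig (fun w => b i * b j * (Z i w * Z j w)).
  exact: integrableZl_fun.
have i1 (i : nat) : ig (fun w => \sum_(j < J) b i * b j * (Z i w * Z j w)).
  by apply: (integrable_sum_fun _ _ (fun j w => b i * b j * (Z i w * Z j w))).
rewrite sqE; split.
  by apply: (integrable_sum_fun _ _
    (fun i w => \sum_(j < J) b i * b j * (Z i w * Z j w))).
rewrite (expectation_sum_fun _ _
  (fun i w => \sum_(j < J) b i * b j * (Z i w * Z j w)))// big_distrr /=.
apply: eq_bigr => i _.
rewrite (expectation_sum_fun _ _ (fun j w => b i * b j * (Z i w * Z j w)))//.
rewrite (bigD1 i)//= big1 => [|j ji].
  by rewrite addr0 RintegralZl// EZ eqxx; ring.
by rewrite RintegralZl// EZ ifN ?mulr0// eq_sym.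
Qed.

Lemma measurable_norm_ge (f : Omega -> R) (eta : R) : measurable_fun setT f ->
  measurable [set w | eta <= `|f w|].
Proof.
move=> mf.
have -> : [set w | eta <= `|f w|] = (fun w => `|f w|) @^-1` `[eta, +oo[.
  by apply/seteqP; split => w /=; rewrite in_itv /= andbT.
by apply: preimage_measurableT => //; exact: measurableT_comp.
Qed.

(** Serves twice: for the noise itself, which gives the linear error of a shift, and for its centred
    squares, which give the fluctuation of the central form. *)
Lemma uncorrelated_chebyshev (b : nat -> R) (J : nat) (eta : R) : 0 < eta ->
  fine (P [set w | eta <= `|\sum_(j < J) b j * Z j w|]) <=
  v * (\sum_(j < J) b j ^+ 2) / eta ^+ 2.
Proof.
move=> eta0; have [i2 E2] := uncorrelated_variance b J.
rewrite ler_pdivlMr ?exprn_gt0// mulrC -E2.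
apply: prob_le_expectation => //.
- apply: measurable_norm_ge; apply: measurable_sum => j.
  exact: measurable_funM.
- by move=> w; exact: sqr_ge0.
- move=> w /= h; rewrite -[leRHS]real_normK ?num_real//.
  by rewrite ler_pXn2r ?nnegrE// ltW.
Qed.

End UncorrelatedSums.

(** * Weighted quadratic forms with finitely many terms *)

Definition quad {R : realType} {Omega : Type} (X : nat -> Omega -> R)
    (a h : nat -> R) (J : nat) (w : Omega) : R :=
  \sum_(j < J) a j * (h j + X j w) ^+ 2.

Definition quad_cdf {R : realType} {d : measure_display} {Omega : measurableType d}
    (P : probability Omega R) (X : nat -> Omega -> R) (a h : nat -> R) (J : nat)
    (x : R) : R := fine (P [set w | quad X a h J w <= x]).

Definition energy {R : realType} (a h : nat -> R) (J : nat) : R :=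
  \sum_(j < J) a j * h j ^+ 2.

(** [mu] is the second moment of each variable and [v] the variance of its square; fourth moments
    make the centred squares square integrable. The two intervals are those of [cf2_two_sets]. *)
Record square_noise {R : realType} {d : measure_display} {Omega : measurableType d}
    (P : probability Omega R) (X : nat -> Omega -> R) (mu v p : R) : Prop := {
  noise_measurable : forall j, measurable_fun setT (X j);
  noise_independent : mutually_independent P X;
  noise_integrable1 : forall j, P.-integrable setT (EFin \o X j);
  noise_integrable2 : forall j, P.-integrable setT (EFin \o (fun w => X j w ^+ 2));
  noise_integrable4 : forall j, P.-integrable setT (EFin \o (fun w => X j w ^+ 4));
  noise_mean : forall j, Rintegral P setT (X j) = 0;
  noise_mean2 : forall j, Rintegral P setT (fun w => X j w ^+ 2) = mu;
  noise_variance2 : forall j,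
    Rintegral P setT (fun w => (X j w ^+ 2 - mu) ^+ 2) = v;
  noise_spread_gt0 : 0 < p;
  noise_low : forall j, p <= fine (P [set w | 0 <= X j w ^+ 2 <= 1]);
  noise_high : forall j, p <= fine (P [set w | 4 <= X j w ^+ 2 <= 9]) }.

Section QuadraticForms.
Context {R : realType} {d : measure_display} {Omega : measurableType d}.
Variables (P : probability Omega R) (X : nat -> Omega -> R) (mu v p : R).
Hypothesis nX : square_noise P X mu v p.
Local Notation ig f := (P.-integrable setT (EFin \o f)).
Local Notation E f := (Rintegral P setT f).
Implicit Types (a h g : nat -> R) (J : nat).

Let mX := noise_measurable _ _ _ _ _ nX.
Let iX := noise_independent _ _ _ _ _ nX.
Let iX1 := noise_integrable1 _ _ _ _ _ nX.
Let iX2 := noise_integrable2 _ _ _ _ _ nX.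
Let iX4 := noise_integrable4 _ _ _ _ _ nX.
Let p0 := noise_spread_gt0 _ _ _ _ _ nX.

Lemma noise_mean2_ge0 : 0 <= mu.
Proof.
rewrite -(noise_mean2 _ _ _ _ _ nX 0%N).
by apply: Rintegral_ge0 => w _; exact: sqr_ge0.
Qed.

Lemma noise_variance2_ge0 : 0 <= v.
Proof.
rewrite -(noise_variance2 _ _ _ _ _ nX 0%N).
by apply: Rintegral_ge0 => w _; exact: sqr_ge0.
Qed.

Lemma measurable_quad a h J : measurable_fun setT (quad X a h J).
Proof.
apply: measurable_sum => j; apply: measurable_funM => //.
by apply: measurable_funX; exact: measurable_funD.
Qed.

Lemma measurable_quad_le a h J x : measurable [set w | quad X a h J w <= x].
Proof.
have -> : [set w | quad X a h J w <= x] = quad X a h J @^-1` `]-oo, x].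
  by apply/seteqP; split => w /=; rewrite in_itv.
by apply: preimage_measurableT => //; exact: measurable_quad.
Qed.

Lemma quad_cdf_ge0 a h J x : 0 <= quad_cdf P X a h J x.
Proof. by rewrite /quad_cdf fine_ge0. Qed.

Lemma energy_ge0 a h J : (forall j, 0 <= a j) -> 0 <= energy a h J.
Proof. by move=> a0; apply: sumr_ge0 => j _; rewrite mulr_ge0// sqr_ge0. Qed.

Lemma fine_prob_le (A B : set Omega) : measurable A -> measurable B ->
  A `<=` B -> fine (P A) <= fine (P B).
Proof.
by move=> mA mB AB; rewrite fine_le ?fin_num_measure// le_measure// inE.
Qed.

Lemma fine_prob_leU (A B C : set Omega) : measurable A -> measurable B ->
  measurable C -> A `<=` B `|` C -> fine (P A) <= fine (P B) + fine (P C).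
Proof.
move=> mA mB mC ABC; rewrite -fineD ?fin_num_measure// fine_le//.
- exact: fin_num_measure.
- by rewrite fin_numD !fin_num_measure.
apply: le_trans (_ : _ <= P (B `|` C))%E _; first by rewrite le_measure// inE//; exact: measurableU.
exact: measureU2.
Qed.

(** The squares of the noise cancel in the difference, and what remains after removing the mean is
    the linear form 2 sum a_j g_j X_j. Its variance 4 mu sum a_j^2 g_j^2 is at most 4 mu m times the
    energy of [g]. *)
Lemma quad_shift_chebyshev a h g J (m eta : R) :
  (forall j, 0 <= a j <= m) -> 0 < eta ->
  fine (P [set w | eta <= `|quad X a (fun j => h j + g j) J w - quad X a h J w
     - (energy a g J + 2 * \sum_(j < J) a j * h j * g j)|]) <=
  4 * mu * m * energy a g J / eta ^+ 2.
Proof.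
move=> am eta0.
have cE i j : E (fun w => X i w * X j w) = if i == j then mu else 0.
  case: eqP => [<-|/eqP ij].
    by rewrite -(noise_mean2 _ _ _ _ _ nX i); apply: eq_Rintegral => w _; rewrite expr2.
  have [_ ->] := independent2_expectationM _ _ _ (mX i) (mX j)
    (mutually_independent2 _ _ iX i j ij) (iX1 i) (iX1 j).
  by rewrite (noise_mean _ _ _ _ _ nX) mul0r.
have cI i j : ig (fun w => X i w * X j w).
  case: (eqVneq i j) => [<-|ij].
    by have := iX2 i; under [in X in _ -> X]eq_fun do rewrite -expr2.
  by have [] := independent2_expectationM _ _ _ (mX i) (mX j)
    (mutually_independent2 _ _ iX i j ij) (iX1 i) (iX1 j).
have -> : [set w | eta <= `|quad X a (fun j => h j + g j) J w - quad X a h J w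
     - (energy a g J + 2 * \sum_(j < J) a j * h j * g j)|] =
  [set w | eta <= `|\sum_(j < J) (2 * a j * g j) * X j w|].
  apply/seteqP; split => w /=; congr (_ <= `|_|);
    rewrite /quad /energy big_distrr /= -sumrB -big_split /= -sumrB;
    apply: eq_bigr => j _; ring.
apply: le_trans (uncorrelated_chebyshev _ _ mu mX cI cE (fun j => 2 * a j * g j) J eta eta0) _.
rewrite ler_pM2r ?invr_gt0 ?exprn_gt0//.
have -> : 4 * mu * m * energy a g J = mu * (4 * m * energy a g J) by ring.
rewrite ler_wpM2l ?noise_mean2_ge0// /energy big_distrr /=.
apply: ler_sum => j _; have /andP[a0 ajm] := am j.
have -> : (2 * a j * g j) ^+ 2 = 4 * a j * (a j * g j ^+ 2) by ring.
have : 0 <= a j * g j ^+ 2 by rewrite mulr_ge0// sqr_ge0.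
by move=> h0; rewrite ler_wpM2r// ler_pM2l.
Qed.

Lemma quad0_chebyshev a J (eta : R) : 0 < eta ->
  fine (P [set w | eta <= `|quad X a (fun=> 0) J w - mu * \sum_(j < J) a j|]) <=
  v * (\sum_(j < J) a j ^+ 2) / eta ^+ 2.
Proof.
move=> eta0; pose Z j w := X j w ^+ 2 - mu.
have mf : measurable_fun setT (fun x : R => x ^+ 2 - mu).
  by apply: measurable_funB => //; exact: measurable_funX.
have mZ j : measurable_fun setT (Z j) by exact: (measurableT_comp mf).
have iZ1 j : ig (Z j) by apply: integrableB_fun => //; exact: integrable_cst_fun.
have EZ1 j : E (Z j) = 0.
  rewrite RintegralB//; last exact: integrable_cst_fun.
  by rewrite (noise_mean2 _ _ _ _ _ nX) expectation_cst_fun subrr.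
have ind i j : i != j -> independent2 P (Z i) (Z j).
  by move=> ij; apply: (independent2_comp _ _ _ _ _ mf mf); exact: mutually_independent2.
have cI i j : ig (fun w => Z i w * Z j w).
  case: (eqVneq i j) => [<-|ij]; last first.
    by have [] := independent2_expectationM _ _ _ (mZ i) (mZ j) (ind i j ij) (iZ1 i) (iZ1 j).
  have -> : (fun w => Z i w * Z i w) =
      (fun w => (X i w ^+ 4 - 2 * mu * X i w ^+ 2) + mu ^+ 2).
    by apply/funext => w; rewrite /Z; ring.
  apply: integrableD_fun; last exact: integrable_cst_fun.
  by apply: integrableB_fun => //; exact: integrableZl_fun.
have cE i j : E (fun w => Z i w * Z j w) = if i == j then v else 0.
  case: eqP => [<-|/eqP ij].
    rewrite -(noise_variance2 _ _ _ _ _ nX i).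
    by apply: eq_Rintegral => w _; rewrite expr2.
  have [_ ->] := independent2_expectationM _ _ _ (mZ i) (mZ j) (ind i j ij) (iZ1 i) (iZ1 j).
  by rewrite EZ1 mul0r.
have := uncorrelated_chebyshev _ _ v mZ cI cE a J eta eta0.
apply: le_trans; rewrite le_eqVlt; apply/orP; left; apply/eqP.
congr (fine (P _)); apply/seteqP; split => w /=; congr (_ <= `|_|);
  rewrite /quad /Z big_distrr /= -sumrB; apply: eq_bigr => j _; ring.
Qed.

(** Squared moduli multiply over independent summands, and 1 - t <= exp(-t) for each factor. The
    summand j is the square of [X j] at frequency u a_j, which u m <= 1/9 keeps in the range of
    [cf2_two_sets]. *)
Lemma quad0_cf2_le a (m u : R) J : (forall j, 0 <= a j <= m) ->
  0 <= u -> u * m <= 9^-1 ->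
  cf2 P (quad X a (fun=> 0) J) u <= expR (- (p / 2 * u ^+ 2 * \sum_(j < J) a j ^+ 2)).
Proof.
move=> am u0 um; elim: J => [|J IH].
  rewrite big_ord0 mulr0 oppr0 expR0 /cf2.
  have -> : E (fun w => cos (u * quad X a (fun=> 0) 0 w)) = 1.
    rewrite -[RHS](expectation_cst_fun P); apply: eq_Rintegral => w _.
    by rewrite /quad big_ord0 mulr0 cos0.
  have -> : E (fun w => sin (u * quad X a (fun=> 0) 0 w)) = 0.
    rewrite -[RHS](expectation_cst_fun P); apply: eq_Rintegral => w _.
    by rewrite /quad big_ord0 mulr0 sin0.
  by rewrite expr1n expr0n addr0.
pose g (j : nat) (x : R) := a j * (0 + x) ^+ 2.
have mg j : measurable_fun setT (g j).
  apply: measurable_funM => //; apply: measurable_funX.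
  exact: measurable_funD.
have -> : quad X a (fun=> 0) J.+1 =
    (fun w => quad X a (fun=> 0) J w + g J (X J w)).
  by apply/funext => w; rewrite /quad big_ord_recr.
have ind : independent2 P (quad X a (fun=> 0) J) (fun w => g J (X J w)).
  have := partial_sum_independent2 P X mX iX g mg J.
  exact: (independent2_comp _ _ _ id (g J) (@measurable_id _ _ _) (mg J)).
rewrite cf2_add//; last 2 first.
- exact: measurable_quad.
- exact: measurableT_comp.
have /andP[aJ0 aJm] := am J.
have cfJ : cf2 P (fun w => g J (X J w)) u <= expR (- (p / 2 * u ^+ 2 * a J ^+ 2)).
  have -> : cf2 P (fun w => g J (X J w)) u = cf2 P (fun w => X J w ^+ 2) (u * a J).
    by rewrite /cf2; congr (_ ^+ 2 + _ ^+ 2); apply: eq_Rintegral => w _;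
      rewrite /g add0r mulrA.
  apply: le_trans (cf2_two_sets P _ p _ _ _ _ _) _.
  - exact: measurable_funX.
  - by rewrite mulr_ge0//= (le_trans _ um)// ler_wpM2l.
  - exact: (noise_low _ _ _ _ _ nX).
  - exact: (noise_high _ _ _ _ _ nX).
  - apply: le_trans (expR_ge1Dx _); rewrite exprMn; lra.
have -> : - (p / 2 * u ^+ 2 * \sum_(j < J.+1) a j ^+ 2) =
    - (p / 2 * u ^+ 2 * \sum_(j < J) a j ^+ 2) + - (p / 2 * u ^+ 2 * a J ^+ 2).
  by rewrite big_ord_recr /=; ring.
rewrite expRD.
by apply: ler_pM => //; exact: cf2_ge0.
Qed.

(** The factor 8 (1 + 2 C) of [anticoncentration] at C = 4 / (p C1). *)
Definition anticoncentration_cst (C1 : R) : R := 8 * (1 + 2 * (4 / (p * C1))).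

Lemma quad0_anticoncentration a (m C1 : R) J (M : nat) :
  (forall j, 0 <= a j <= m) -> 0 < C1 -> C1 <= \sum_(j < J) a j ^+ 2 ->
  (0 < M)%N -> M%:R * m <= 9^-1 ->
  forall x, fine (P [set w | `|quad X a (fun=> 0) J w - x| <= M%:R^-1]) <=
    anticoncentration_cst C1 / M%:R.
Proof.
move=> am C10 C1a M0 Mm; apply: anticoncentration => //.
- exact: measurable_quad.
- by rewrite divr_ge0// mulr_ge0// ltW.
move=> k /andP[k0 kM].
have m0 : 0 <= m by have /andP[h1 h2] := am 0%N; exact: le_trans h1 h2.
have k0' : 0 < k%:R :> R by rewrite ltr0n.
apply: le_trans (quad0_cf2_le _ m _ _ am _ _) _ => //.
  by apply: le_trans Mm; rewrite ler_wpM2r// ler_nat ltnW.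
set y := p / 2 * k%:R ^+ 2 * C1.
have y0 : 0 < y by rewrite /y !mulr_gt0// ?exprn_gt0// invr_gt0.
(* This gives exp(-y) <= (2 / y)^2, which turns the exponential bound into the k^-4 decay of squared
   moduli; 2 / y is C / k^2 for the chosen C. *)
have ey : y / 2 <= expR (y / 2) by have := expR_ge1Dx (y / 2); lra.
apply: (@le_trans _ _ (expR (- y))).
  by rewrite ler_expR lerN2 /y ler_wpM2l// !mulr_ge0 ?exprn_ge0// ?invr_ge0// ltW.
have -> : 4 / (p * C1) / k%:R ^+ 2 = (y / 2)^-1.
  by rewrite /y; field; rewrite !gt_eqF.
have -> : expR (- y) = (expR (y / 2))^-1 ^+ 2.
  by rewrite -expRN expr2 -expRD; congr expR; lra.
rewrite ler_pXn2r ?nnegrE ?invr_ge0 ?expR_ge0//; last by rewrite divr_ge0// ltW.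
by rewrite lef_pV2 ?posrE ?expR_gt0// divr_gt0.
Qed.

End QuadraticForms.

(** * Distribution functions of the finite forms *)

Section QuadraticCdf.
Context {R : realType} {d : measure_display} {Omega : measurableType d}.
Variables (P : probability Omega R) (X : nat -> Omega -> R) (mu v p : R).
Hypothesis nX : square_noise P X mu v p.
Implicit Types (a h g : nat -> R) (J : nat).

Let mquad a h J : measurable_fun setT (quad X a h J).
Proof. exact: (measurable_quad _ _ _ _ _ nX). Qed.

Let mle a h J x : measurable [set w | quad X a h J w <= x].
Proof. exact: (measurable_quad_le _ _ _ _ _ nX). Qed.

Let mu0 : 0 <= mu. Proof. exact: (noise_mean2_ge0 _ _ _ _ _ nX). Qed.
Let v0 : 0 <= v. Proof. exact: (noise_variance2_ge0 _ _ _ _ _ nX). Qed.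

Lemma quad0_shift_chebyshev a h J (m eta : R) :
  (forall j, 0 <= a j <= m) -> 0 < eta ->
  fine (P [set w | eta <= `|quad X a h J w - quad X a (fun=> 0) J w
     - energy a h J|]) <= 4 * mu * m * energy a h J / eta ^+ 2.
Proof.
move=> am eta0.
have := quad_shift_chebyshev _ _ _ _ _ nX a (fun=> 0) h J m eta am eta0.
have -> : (fun j => 0 + h j) = h by apply/funext => j; rewrite add0r.
have -> : \sum_(j < J) a j * 0 * h j = 0.
  by rewrite big1// => j _; rewrite mulr0 mul0r.
by rewrite mulr0 addr0.
Qed.

(** Outside an event of small probability the signal raises the form by more than half of its
    energy; 16 is 4 divided by (1/2)^2. *)
Lemma quad_cdf_shift_le a h J (m x : R) : (forall j, 0 <= a j <= m) ->
  0 < energy a h J ->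
  quad_cdf P X a h J x <=
  quad_cdf P X a (fun=> 0) J (x - energy a h J / 2) + 16 * mu * m / energy a h J.
Proof.
move=> am D0; set D := energy a h J.
have D2 : 0 < D / 2 by rewrite divr_gt0.
have e : 16 * mu * m / D = 4 * mu * m * D / (D / 2) ^+ 2.
  by field; rewrite gt_eqF.
rewrite e; apply: le_trans _ (lerD (lexx _) (quad0_shift_chebyshev a h J m _ am D2)).
apply: fine_prob_leU => //.
  by apply: measurable_norm_ge; do 2 (apply: measurable_funB => //).
move=> w /= Sx; have [le|] := leP (D / 2) `|quad X a h J w - quad X a (fun=> 0) J w - D|.
  by right.
by rewrite ltr_norml => /andP[h1 h2]; left; lra.
Qed.

(** Up to errors [eta], the form with signal [h] is the central form plus the energy of [h], and
    adding [g] moves it further by the drift [c]. The two forms fall on different sides of [x] only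
    if an error reaches [eta] or the central form lies within |c| + 2 eta of x - Dh. Chebyshev
    bounds the former, anticoncentration the latter; [tau] balances the cross term in [c]. *)
Lemma quad_cdf_diff_le a h g J (m C1 tau eta x : R) (M : nat) :
  (forall j, 0 <= a j <= m) -> 0 < C1 -> C1 <= \sum_(j < J) a j ^+ 2 ->
  (0 < M)%N -> M%:R * m <= 9^-1 -> 0 < tau -> 0 < eta ->
  energy a g J + (tau * energy a h J + energy a g J / tau) + 2 * eta <= M%:R^-1 ->
  `|quad_cdf P X a h J x - quad_cdf P X a (fun j => h j + g j) J x| <=
  anticoncentration_cst p C1 / M%:R
  + 4 * mu * m * (energy a h J + energy a g J) / eta ^+ 2.
Proof.
move=> am C10 C1a M0 Mm tau0 eta0 small.
set Dg := energy a g J in small *; set Dh := energy a h J in small *.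
set hg := fun j => h j + g j.
set c := Dg + 2 * \sum_(j < J) a j * h j * g j.
have Dg0 : 0 <= Dg by apply: energy_ge0 => j; have /andP[] := am j.
have hc : `|c| <= Dg + (tau * Dh + Dg / tau).
  rewrite (le_trans (ler_normD _ _))// ger0_norm// lerD2l.
  rewrite /Dh /Dg /energy big_distrr big_distrl !big_distrr /= -big_split /=.
  apply: le_trans (ler_norm_sum _ _ _) _; apply: ler_sum => j _.
  have /andP[aj _] := am j.
  have t0 : 0 < tau^-1 by rewrite invr_gt0.
  have tt : tau * tau^-1 = 1 by rewrite mulfV// gt_eqF.
  (* The squares of tau h_j - g_j and tau h_j + g_j, weighted by a_j / tau, bound the cross term
     from both sides. *)
  have h1 := mulr_ge0 aj (mulr_ge0 (ltW t0) (sqr_ge0 (tau * h j - g j))).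
  have h2 := mulr_ge0 aj (mulr_ge0 (ltW t0) (sqr_ge0 (tau * h j + g j))).
  have e1 (s : R) : s ^+ 2 = 1 -> a j * (tau^-1 * (tau * h j + s * g j) ^+ 2) =
      tau * (a j * h j ^+ 2) + a j * g j ^+ 2 / tau + s * (2 * (a j * h j * g j)).
    move=> s1.
    have -> : a j * (tau^-1 * (tau * h j + s * g j) ^+ 2) =
      (tau * tau^-1) * tau * (a j * h j ^+ 2) + s ^+ 2 * (a j * g j ^+ 2 / tau)
      + (tau * tau^-1) * (s * (2 * (a j * h j * g j))) by ring.
    by rewrite tt s1 !mul1r.
  have e2 := e1 1 (expr1n _ _); have e3 := e1 (-1) (etrans (sqrrN 1) (expr1n _ 2)).
  by rewrite ler_norml; move: h1 h2 e2 e3; rewrite !mulN1r !mul1r; lra.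
pose G := [set w | `|quad X a (fun=> 0) J w - (x - Dh)| <= M%:R^-1].
pose e1 := [set w | eta <= `|quad X a hg J w - quad X a h J w - c|].
pose e2 := [set w | eta <= `|quad X a h J w - quad X a (fun=> 0) J w - Dh|].
have mG : measurable G.
  have -> : G = (fun w => `|quad X a (fun=> 0) J w - (x - Dh)|) @^-1` `]-oo, M%:R^-1].
    by apply/seteqP; split => w /=; rewrite in_itv.
  apply: preimage_measurableT => //.
  by apply: measurableT_comp => //; exact: measurable_funB.
have me1 : measurable e1 by apply: measurable_norm_ge; do 2 (apply: measurable_funB => //).
have me2 : measurable e2 by apply: measurable_norm_ge; do 2 (apply: measurable_funB => //).
have bad : fine (P (G `|` (e1 `|` e2))) <= anticoncentration_cst p C1 / M%:R
    + 4 * mu * m * (Dh + Dg) / eta ^+ 2.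
  have b0 := quad0_anticoncentration _ _ _ _ _ nX a m C1 J M am C10 C1a M0 Mm (x - Dh).
  have b1 := quad_shift_chebyshev _ _ _ _ _ nX a h g J m eta am eta0.
  have b2 := quad0_shift_chebyshev a h J m eta am eta0.
  have m12 := measurableU _ _ me1 me2.
  have u1 := fine_prob_leU P (G `|` (e1 `|` e2)) G (e1 `|` e2)
    (measurableU _ _ mG m12) mG m12 (@subset_refl _ _).
  have u2 := fine_prob_leU P (e1 `|` e2) e1 e2 m12 me1 me2 (@subset_refl _ _).
  apply: (le_trans u1); apply: lerD; first exact: b0.
  apply: (le_trans u2); rewrite mulrDr mulrDl addrC; exact: lerD.
have mB : measurable (G `|` (e1 `|` e2)) by exact: measurableU (measurableU _ _ me1 me2).
have key w : ~ (G `|` (e1 `|` e2)) w ->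
    (quad X a h J w <= x) = (quad X a hg J w <= x).
  move=> /not_orP[nG /not_orP[/negP ne1 /negP ne2]].
  move: ne1 ne2; rewrite -!ltNge !ltr_norml => /andP[h1 h2] /andP[h3 h4].
  move: hc; rewrite ler_norml => /andP[h5 h6].
  move/negP: nG; rewrite -ltNge => nG.
  apply/idP/idP => hx; rewrite leNgt; apply/negP => hx'; move: nG; apply/negP;
    rewrite -leNgt ler_norml; apply/andP; split; lra.
apply: le_trans bad; rewrite ler_norml /quad_cdf; apply/andP; split.
  rewrite lerNl opprB lerBlDl.
  apply: fine_prob_leU => // w /= hx.
  have [hb|/key E] := pselect ((G `|` (e1 `|` e2)) w); first by right.
  by left; rewrite E.
rewrite lerBlDl.
apply: fine_prob_leU => // w /= hx.
have [hb|/key E] := pselect ((G `|` (e1 `|` e2)) w); first by right.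
by left; rewrite -E.
Qed.

Lemma quad0_cdf_left_tail a J (C2 L : R) : \sum_(j < J) a j ^+ 2 <= C2 -> 0 < L ->
  quad_cdf P X a (fun=> 0) J (mu * (\sum_(j < J) a j) - L) <= v * C2 / L ^+ 2.
Proof.
move=> aC2 L0; have := quad0_chebyshev _ _ _ _ _ nX a J L L0 => h.
apply: (@le_trans _ _ (v * (\sum_(j < J) a j ^+ 2) / L ^+ 2)).
  apply: le_trans h; apply: fine_prob_le => //.
    by apply: measurable_norm_ge; apply: measurable_funB => //.
  by move=> w /= h; rewrite ler_normr; apply/orP; right; lra.
by rewrite ler_wpM2r ?invr_ge0 ?sqr_ge0// ler_wpM2l.
Qed.

Lemma quad0_cdf_right_tail a J (C2 L : R) : \sum_(j < J) a j ^+ 2 <= C2 -> 0 < L ->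
  1 - quad_cdf P X a (fun=> 0) J (mu * (\sum_(j < J) a j) + L) <= v * C2 / L ^+ 2.
Proof.
move=> aC2 L0; have := quad0_chebyshev _ _ _ _ _ nX a J L L0 => h.
apply: (@le_trans _ _ (v * (\sum_(j < J) a j ^+ 2) / L ^+ 2)).
  rewrite lerBlDl; apply: le_trans _ (lerD (lexx _) h).
  have -> : 1 = fine (P setT) by rewrite probability_setT.
  apply: fine_prob_leU => //.
    by apply: measurable_norm_ge; apply: measurable_funB => //.
  move=> w _ /=; have [|hx] := leP (quad X a (fun=> 0) J w) (mu * (\sum_(j < J) a j) + L).
    by left.
  by right; rewrite ler_normr; apply/orP; left; lra.
by rewrite ler_wpM2r ?invr_ge0 ?sqr_ge0// ler_wpM2l.
Qed.

Lemma quad_cdf_mono a h J (x y : R) : x <= y ->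
  quad_cdf P X a h J x <= quad_cdf P X a h J y.
Proof.
by move=> xy; apply: fine_prob_le => // w /= hw; exact: le_trans hw xy.
Qed.

Lemma energyD_ge a h g J : (forall j, 0 <= a j) ->
  energy a h J / 2 - energy a g J <= energy a (fun j => h j + g j) J.
Proof.
move=> a0; rewrite /energy big_distrl /= -sumrB; apply: ler_sum => j _.
have := mulr_ge0 (a0 j) (sqr_ge0 (h j / 2 + g j)).
have := mulr_ge0 (a0 j) (sqr_ge0 (h j + 2 * g j)).
by nra.
Qed.

(** The hypothesis on the right tail puts [x] below mu sum a_j + K. Moving left by half of the
    energy, at least K + L, brings it below mu sum a_j - L, into the left tail of the central
    form. *)
Lemma quad_cdf_large_energy a h J (m C2 K L x : R) :
  (forall j, 0 <= a j <= m) -> \sum_(j < J) a j ^+ 2 <= C2 -> 0 < K -> 0 < L ->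
  v * C2 / K ^+ 2 < 1 - quad_cdf P X a (fun=> 0) J x ->
  2 * (K + L) <= energy a h J ->
  quad_cdf P X a h J x <= v * C2 / L ^+ 2 + 16 * mu * m / energy a h J.
Proof.
move=> am aC2 K0 L0 hx D.
have D0 : 0 < energy a h J by apply: lt_le_trans D; lra.
apply: le_trans (quad_cdf_shift_le a h J m x am D0) _; rewrite lerD2r.
apply: le_trans (quad0_cdf_left_tail a J C2 L aC2 L0).
apply: quad_cdf_mono.
have xK : x <= mu * (\sum_(j < J) a j) + K.
  rewrite leNgt; apply/negP => hx'.
  have := quad0_cdf_right_tail a J C2 K aC2 K0.
  have := quad_cdf_mono a (fun=> 0) J _ _ (ltW hx').
  by lra.
by lra.
Qed.

(** [delta] and [m0] precede the weights, signals, length and threshold, so the estimate survives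
    the passage to infinite sums. If the energy of [h] is at least [B], both distribution functions
    are at most [eps]; below [B], [quad_cdf_diff_le] applies. *)
Lemma quad_cdf_stable (C1 C2 alpha eps : R) :
  0 < C1 -> 0 <= C2 -> 0 < alpha -> 0 < eps ->
  exists delta m0 : R, [/\ 0 < delta, 0 < m0 &
    forall a h g J x, (forall j, 0 <= a j <= m0) ->
      C1 <= \sum_(j < J) a j ^+ 2 <= C2 -> energy a g J <= delta ->
      alpha <= 1 - quad_cdf P X a (fun=> 0) J x ->
      `|quad_cdf P X a h J x - quad_cdf P X a (fun j => h j + g j) J x| <= eps].
Proof.
move=> C10 C20 al0 e0.
pose V := v * C2; have V0 : 0 <= V by rewrite mulr_ge0.
(* [K] makes the right tail V / K^2 smaller than [alpha], and [L] makes the left tail V / L^2 at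
   most eps / 2. *)
pose K := 1 + V / alpha; pose L := 1 + 2 * V / eps.
have K1 : 1 <= K by rewrite lerDl divr_ge0// ltW.
have L1 : 1 <= L by rewrite lerDl divr_ge0// ?mulr_ge0// ltW.
have K0 : 0 < K by lra.
have L0 : 0 < L by lra.
have VK : V / K ^+ 2 < alpha.
  rewrite ltr_pdivrMr ?exprn_gt0//.
  have : alpha * K = alpha + V by rewrite /K mulrDr mulr1 mulrCA mulfV ?mulr1// gt_eqF.
  by nra.
have VL : V / L ^+ 2 <= eps / 2.
  rewrite ler_pdivrMr ?exprn_gt0//.
  have : eps * L = eps + 2 * V by rewrite /L mulrDr mulr1 mulrCA mulfV ?mulr1// gt_eqF.
  by nra.
(* As delta <= 1, [energyD_ge] leaves h + g an energy of at least B / 2 - 1 = 2 (K + L), which is at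
   least 4 since K and L are at least 1. *)
pose B := 4 * (K + L) + 2; have B0 : 0 < B by rewrite /B; lra.
pose Q := anticoncentration_cst p C1.
have Q0 : 0 <= Q.
  have p0 := noise_spread_gt0 _ _ _ _ _ nX.
  have : 0 <= 4 / (p * C1) by rewrite divr_ge0// mulr_ge0// ltW.
  by rewrite /Q /anticoncentration_cst; set z := 4 / _; lra.
pose M := (Num.truncn (2 * Q / eps)).+1.
have M0 : 0 < M%:R :> R by rewrite ltr0n.
have QM : Q / M%:R <= eps / 2.
  rewrite ler_pdivrMr//.
  have : 2 * Q / eps < M%:R by exact: truncnS_gt.
  by rewrite ltr_pdivrMr//; lra.
(* A quarter of the window 1 / M: one share for the terms in the energy of [g], one for tau times
   the energy of [h], two for the Chebyshev errors. *)
pose eta : R := (4 * M%:R)^-1; have eta0 : 0 < eta by rewrite invr_gt0 mulr_gt0.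
have etaM : M%:R^-1 = 4 * eta by rewrite /eta; field; rewrite gt_eqF.
pose tau := eta / B; have tau0 : 0 < tau by rewrite divr_gt0.
have tauB : tau * B = eta by rewrite /tau divfK// gt_eqF.
pose T := 1 + tau^-1; have T1 : 1 < T by rewrite ltrDl invr_gt0.
pose delta := Num.min 1 (eta / T).
have delta0 : 0 < delta by rewrite lt_min ltr01 divr_gt0//; lra.
have deltaT : delta * T <= eta.
  by rewrite -ler_pdivlMr ?ge_min ?lexx ?orbT//; lra.
have delta1 : delta <= 1 by rewrite ge_min lexx.
(* [c1] ensures M m0 <= 1/9, [c2] controls the Chebyshev errors when the energy of [h] is below [B],
   and [c3] those when it is large. *)
pose c1 : R := (9 * M%:R)^-1; pose c2 := eps * eta ^+ 2 / (8 * (mu + 1) * (1 + B)).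
pose c3 := eps / (8 * (mu + 1)).
pose m0 := Num.min c1 (Num.min c2 c3).
have mu1 : 0 < mu + 1 by rewrite ltr_wpDl.
have c10 : 0 < c1 by rewrite invr_gt0 mulr_gt0.
have c20 : 0 < c2 by rewrite divr_gt0 ?mulr_gt0 ?exprn_gt0//; lra.
have c30 : 0 < c3 by rewrite divr_gt0 ?mulr_gt0.
have m00 : 0 < m0 by rewrite !lt_min c10 c20.
have m0c1 : m0 <= c1 by rewrite ge_min lexx.
have m0c2 : m0 <= c2 by rewrite !ge_min lexx orbT.
have m0c3 : m0 <= c3 by rewrite !ge_min lexx !orbT.
exists delta, m0; split => // a h g J x am /andP[aC1 aC2] Dg hx.
have a0 j : 0 <= a j by have /andP[] := am j.
have Dg0 := energy_ge0 a g J a0; have Dh0 := energy_ge0 a h J a0.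
have big (D : R) : 4 <= D -> 16 * mu * m0 / D <= eps / 2.
  move=> D4; rewrite ler_pdivrMr; last by lra.
  have : m0 * (8 * (mu + 1)) <= eps by rewrite -ler_pdivlMr ?mulr_gt0.
  by nra.
have VKx : v * C2 / K ^+ 2 < 1 - quad_cdf P X a (fun=> 0) J x.
  exact: lt_le_trans VK hx.
have [DB|DB] := leP B (energy a h J).
  have s1 := quad_cdf_large_energy a h J m0 C2 K L x am aC2 K0 L0 VKx.
  have s2 := quad_cdf_large_energy a (fun j => h j + g j) J m0 C2 K L x am aC2 K0 L0 VKx.
  have D2 := energyD_ge a h g J a0.
  have {}s1 : quad_cdf P X a h J x <= eps.
    apply: le_trans (s1 _) _; first by move: DB; rewrite /B; lra.
    have := big (energy a h J); rewrite -/V; move: VL DB; rewrite /B.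
    by set y := V / L ^+ 2; set z := _ / energy _ _ _; lra.
  have {}s2 : quad_cdf P X a (fun j => h j + g j) J x <= eps.
    apply: le_trans (s2 _) _; first by move: DB; rewrite /B; lra.
    have := big (energy a (fun j => h j + g j) J); rewrite -/V; move: VL DB D2; rewrite /B.
    by set y := V / L ^+ 2; set z := _ / energy _ _ _; lra.
  have := quad_cdf_ge0 P X a h J x; have := quad_cdf_ge0 P X a (fun j => h j + g j) J x.
  by move=> ? ?; rewrite ler_norml; lra.
apply: le_trans (quad_cdf_diff_le a h g J m0 C1 tau eta x M _ _ _ _ _ _ _ _) _ => //.
- have : m0 * (9 * M%:R) <= 1 by rewrite -ler_pdivlMr ?mulr_gt0// mul1r.
  by lra.
- rewrite etaM.
  have : tau * energy a h J <= eta by rewrite -tauB ler_pM2l// ltW.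
  have : energy a g J + energy a g J / tau <= eta.
    rewrite -[X in X + _]mulr1 -mulrDr -/T; apply: le_trans deltaT.
    by rewrite ler_wpM2r//; lra.
  by set y := _ / tau; set z := tau * _; lra.
rewrite -/Q [eps]splitr; apply: lerD => //.
rewrite ler_pdivrMr ?exprn_gt0//.
have h1 : m0 * (8 * (mu + 1) * (1 + B)) <= eps * eta ^+ 2.
  by rewrite -ler_pdivlMr// !mulr_gt0//; lra.
have h2 : energy a h J + energy a g J <= 1 + B by lra.
have h3 : 4 * mu * m0 * (energy a h J + energy a g J) <= 4 * mu * m0 * (1 + B).
  by rewrite ler_wpM2l// !mulr_ge0// ltW.
apply: (le_trans h3).
have h4 : 0 <= m0 * (1 + B) by rewrite mulr_ge0//; lra.
by nra.
Qed.

End QuadraticCdf.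

(** * Passage to infinite sums *)

(** Extended real values let the series diverge; a divergent sum exceeds every threshold. *)
Definition quad_series {R : realType} {Omega : Type} (X : nat -> Omega -> R)
    (a h : nat -> R) (w : Omega) : \bar R :=
  (\sum_(0 <= j <oo) (a j * (h j + X j w) ^+ 2)%:E)%E.

Definition series_cdf {R : realType} {d : measure_display} {Omega : measurableType d}
    (P : probability Omega R) (X : nat -> Omega -> R) (a h : nat -> R) (x : R) : R :=
  fine (P [set w | (quad_series X a h w <= x%:E)%E]).

Lemma limn_einf_ge_near (R : realType) (u : nat -> R) (l eps : R) : 0 < eps ->
  (l%:E <= limn_einf (fun n => (u n)%:E))%E -> \forall n \near \oo, l - eps <= u n.
Proof.
move=> e0; rewrite limn_einf_lim.
have -> : limn (einfs (fun n => (u n)%:E)) =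
    ereal_sup (range (einfs (fun n => (u n)%:E))).
  by apply/cvg_lim => //; exact: cvg_einfs_sup.
move=> lu.
have : ((l - eps)%:E < ereal_sup (range (einfs (fun n => (u n)%:E))))%E.
  by apply: lt_le_trans lu; rewrite lte_fin; lra.
move=> /ereal_sup_gt[_ [N _ <-] lN]; exists N => // n /= Nn.
rewrite -lee_fin; apply: (le_trans (ltW lN)).
by apply: ereal_inf_lbound; exists n.
Qed.

Section SeriesCdf.
Context {R : realType} {d : measure_display} {Omega : measurableType d}.
Variables (P : probability Omega R) (X : nat -> Omega -> R) (mu v p : R).
Hypothesis nX : square_noise P X mu v p.
Implicit Types (a h g : nat -> R) (J : nat).

Let mle a h J x : measurable [set w | quad X a h J w <= x].
Proof. exact: (measurable_quad_le _ _ _ _ _ nX). Qed.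

Let mu0 : 0 <= mu. Proof. exact: (noise_mean2_ge0 _ _ _ _ _ nX). Qed.
Let v0 : 0 <= v. Proof. exact: (noise_variance2_ge0 _ _ _ _ _ nX). Qed.

Lemma quad_series_leP a h (x : R) (w : Omega) : (forall j, 0 <= a j) ->
  (quad_series X a h w <= x%:E)%E <-> forall J, quad X a h J w <= x.
Proof.
move=> a0.
have t0 (n : nat) : (0 <= n)%N -> true -> (0 <= (a n * (h n + X n w) ^+ 2)%:E)%E.
  by move=> _ _; rewrite lee_fin mulr_ge0// sqr_ge0.
have qE J : (\sum_(0 <= j < J) (a j * (h j + X j w) ^+ 2)%:E)%E = (quad X a h J w)%:E.
  by rewrite /quad big_mkord sumEFin.
split=> [le J|le].
  rewrite -lee_fin -qE; apply: le_trans le; exact: nneseries_lim_ge.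
apply: lime_le; first exact: is_cvg_nneseries.
by apply: nearW => J; rewrite qE lee_fin.
Qed.

Let series_leE a h x : (forall j, 0 <= a j) ->
  [set w | (quad_series X a h w <= x%:E)%E] =
  \bigcap_J [set w | quad X a h J w <= x].
Proof.
move=> a0; apply/seteqP; split => w /=.
  by move=> /(quad_series_leP _ _ _ _ a0) hw J _ /=.
by move=> hw; apply/(quad_series_leP _ _ _ _ a0) => J; exact: hw.
Qed.

Lemma measurable_series_le a h x : (forall j, 0 <= a j) ->
  measurable [set w | (quad_series X a h w <= x%:E)%E].
Proof. by move=> a0; rewrite series_leE//; exact: bigcapT_measurable. Qed.

(** The event for the series is the decreasing intersection of the events for its partial sums, and
    the measure is continuous from above. *)
Lemma quad_cdf_cvg a h x : (forall j, 0 <= a j) ->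
  (fun J => quad_cdf P X a h J x) @ \oo --> series_cdf P X a h x.
Proof.
move=> a0; rewrite /quad_cdf /series_cdf.
apply: fine_cvg; rewrite fineK; last first.
  by rewrite fin_num_measure//; exact: measurable_series_le.
rewrite series_leE//; apply: nonincreasing_cvg_mu => //.
- by apply: le_lt_trans (ltry 1); exact: probability_le1.
- exact: bigcapT_measurable.
- move=> J J' JJ'; apply/subsetPset => w /=; apply: le_trans.
  rewrite /quad -!(big_mkord xpredT (fun j => a j * (h j + X j w) ^+ 2)).
  rewrite (big_cat_nat (leq0n J) JJ') /= lerDl.
  by apply: sumr_ge0 => j _; rewrite mulr_ge0// sqr_ge0.
Qed.

Lemma series_cdf_le_quad_cdf a h J x : (forall j, 0 <= a j) ->
  series_cdf P X a h x <= quad_cdf P X a h J x.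
Proof.
move=> a0; apply: fine_prob_le => //; first exact: measurable_series_le.
by move=> w /= /(quad_series_leP _ _ _ _ a0).
Qed.

Lemma energy_mono a h J J' : (forall j, 0 <= a j) -> (J <= J')%N ->
  energy a h J <= energy a h J'.
Proof.
move=> a0 JJ'; rewrite /energy -!(big_mkord xpredT (fun j => a j * h j ^+ 2)).
rewrite (big_cat_nat (leq0n J) JJ') /= lerDl.
by apply: sumr_ge0 => j _; rewrite mulr_ge0// sqr_ge0.
Qed.

(** The series with signal is bounded by any of its partial sums, while the central distribution
    function is a limit over the length. Partial energies increase, so one error term serves all
    lengths beyond [J]. *)
Lemma series_cdf_shift_le a h J (m delta x : R) : (forall j, 0 <= a j <= m) ->
  0 < delta -> delta <= energy a h J ->
  series_cdf P X a h x <=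
  series_cdf P X a (fun=> 0) (x - delta / 2) + 16 * mu * m / delta.
Proof.
move=> am d0 dD.
have a0 j : 0 <= a j by have /andP[] := am j.
have m0 : 0 <= m by have /andP[h1 h2] := am 0%N; exact: le_trans h1 h2.
rewrite -lerBlDr.
apply: (cvgr_to_ge (quad_cdf_cvg a (fun=> 0) (x - delta / 2) a0)).
exists J => // J' /= JJ'.
have dD' : delta <= energy a h J' by apply: le_trans dD _; exact: energy_mono.
have D0 := lt_le_trans d0 dD'.
rewrite lerBlDr; apply: le_trans (series_cdf_le_quad_cdf a h J' x a0) _.
apply: le_trans (quad_cdf_shift_le _ _ _ _ _ nX a h J' m x am D0) _.
apply: lerD.
  by apply: (quad_cdf_mono _ _ _ _ _ nX); lra.
by rewrite ler_wpM2l ?mulr_ge0// lef_pV2.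
Qed.

Lemma series_cdf_stable (C1 C2 alpha eps : R) :
  0 < C1 -> 0 <= C2 -> 0 < alpha -> 0 < eps ->
  exists delta m0 : R, [/\ 0 < delta, 0 < m0 &
    forall a h g x, (forall j, 0 <= a j <= m0) ->
      (exists J, C1 <= \sum_(j < J) a j ^+ 2) ->
      (forall J, \sum_(j < J) a j ^+ 2 <= C2) ->
      (forall J, energy a g J <= delta) ->
      alpha < 1 - series_cdf P X a (fun=> 0) x ->
      `|series_cdf P X a h x - series_cdf P X a (fun j => h j + g j) x| <= eps].
Proof.
move=> C10 C20 al0 e0.
have [delta [m0 [d0 m00 st]]] :=
  quad_cdf_stable _ _ _ _ _ nX C1 C2 alpha eps C10 C20 al0 e0.
exists delta, m0; split => // a h g x am [J0 aC1] aC2 Dg hx.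
have a0 j : 0 <= a j by have /andP[] := am j.
have cv : (fun J => `|quad_cdf P X a h J x - quad_cdf P X a (fun j => h j + g j) J x|)
    @ \oo --> `|series_cdf P X a h x - series_cdf P X a (fun j => h j + g j) x|.
  by apply: cvg_norm; apply: cvgB; exact: quad_cdf_cvg.
apply: (cvgr_to_le cv).
have c0 := quad_cdf_cvg a (fun=> 0) x a0.
(* The inequality for the level is strict so that it persists for long partial sums. *)
have hx' : series_cdf P X a (fun=> 0) x < 1 - alpha by lra.
have n1 := cvgr_lt _ c0 _ hx'.
have n2 : \forall J \near \oo, (J0 <= J)%N by exists J0.
near=> J.
have h1 : quad_cdf P X a (fun=> 0) J x < 1 - alpha by near: J; exact: n1.
have h2 : (J0 <= J)%N by near: J; exact: n2.
apply: st => //; last by lra.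
rewrite aC2 andbT; apply: (le_trans aC1).
rewrite -!(big_mkord xpredT (fun j => a j ^+ 2)) (big_cat_nat (leq0n J0) h2) /= lerDl.
by apply: sumr_ge0 => j _; exact: sqr_ge0.
Unshelve. all: by end_near.
Qed.

(* The variance bound confines half of the mass to an interval of bounded
   length, so one of boundedly many steps of size [delta / 2] carries a jump. *)
Lemma series_cdf_increment (C2 delta : R) : 0 <= C2 -> 0 < delta ->
  exists2 q : R, 0 < q &
    forall a, (forall j, 0 <= a j) -> (forall J, \sum_(j < J) a j ^+ 2 <= C2) ->
      (exists A, forall J, \sum_(j < J) a j <= A) ->
      exists x, q <= series_cdf P X a (fun=> 0) x -
                     series_cdf P X a (fun=> 0) (x - delta / 2).
Proof.
move=> C20 d0.
pose V := v * C2; have V0 : 0 <= V by rewrite mulr_ge0.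
(* 8 V <= L^2, so each tail beyond [L] has mass at most 1/8. *)
pose L := 1 + 8 * V; have L0 : 0 < L by rewrite /L; lra.
have VL : V / L ^+ 2 <= 8^-1.
  by rewrite ler_pdivrMr ?exprn_gt0//; rewrite /L; nra.
(* Length of the interval from mu A - mu - L to mu A + L, where [A] is the supremum of the partial
   sums of weights. The extra [mu] pays for using a partial sum within 1 of [A] on the left. *)
pose W := 2 * L + mu.
have W0 : 0 < W by rewrite /W ltr_pwDl// mulr_gt0.
pose N := (Num.truncn (W / (delta / 2))).+1.
have NW : W < N%:R * (delta / 2) by rewrite -ltr_pdivrMr ?divr_gt0//; exact: truncnS_gt.
have N0 : 0 < N%:R :> R by rewrite ltr0n.
(* If each of the N steps gained less than 1 / (2 N), the total gain would be at most 1/2, short of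
   7/8 - 1/8. *)
exists ((2 * N%:R)^-1) => [|a a0 aC2 [A' aA]]; first by rewrite invr_gt0 mulr_gt0.
pose S := [set \sum_(j < J) a j | J in [set: nat]].
have S0 : has_sup S.
  by split; [exists (\sum_(j < 0) a j), 0%N|exists A' => _ [J _ <-]].
pose A := sup S.
have AJ J : \sum_(j < J) a j <= A by apply: sup_upper_bound => //; exists J.
have [_ [J1 _ <-] AJ1] := sup_adherent ltr01 S0.
pose F := series_cdf P X a (fun=> 0).
have right : 7 / 8 <= F (mu * A + L).
  apply: (cvgr_to_ge (quad_cdf_cvg a (fun=> 0) (mu * A + L) a0)).
  apply: nearW => J.
  have := quad0_cdf_right_tail _ _ _ _ _ nX a J C2 L (aC2 J) L0.
  have : quad_cdf P X a (fun=> 0) J (mu * (\sum_(j < J) a j) + L) <=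
         quad_cdf P X a (fun=> 0) J (mu * A + L).
    by apply: (quad_cdf_mono _ _ _ _ _ nX); rewrite lerD2r ler_wpM2l.
  by move: VL; rewrite -/V; set y := V / _; lra.
have left : F (mu * A - mu - L) <= 1 / 8.
  apply: le_trans (series_cdf_le_quad_cdf a (fun=> 0) J1 _ a0) _.
  have := quad0_cdf_left_tail _ _ _ _ _ nX a J1 C2 L (aC2 J1) L0.
  have : quad_cdf P X a (fun=> 0) J1 (mu * A - mu - L) <=
         quad_cdf P X a (fun=> 0) J1 (mu * (\sum_(j < J1) a j) - L).
    apply: (quad_cdf_mono _ _ _ _ _ nX); rewrite lerD2r.
    rewrite -{2}(mulr1 mu) -mulrBr ler_wpM2l//.
    by move: AJ1; rewrite -/A; lra.
  by move: VL; rewrite -/V; set y := V / _; lra.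
apply: contrapT => /forallNP none.
pose x0 := mu * A - mu - L.
have step k : F (x0 + k%:R * (delta / 2)) <= F x0 + k%:R / (2 * N%:R).
  elim: k => [|k IH]; first by rewrite !mul0r !addr0.
  have /negP := none (x0 + k.+1%:R * (delta / 2)); rewrite -ltNge.
  have -> : x0 + k.+1%:R * (delta / 2) - delta / 2 = x0 + k%:R * (delta / 2).
    by rewrite -natr1; ring.
  rewrite -/F => h.
  have -> : k.+1%:R / (2 * N%:R) = k%:R / (2 * N%:R) + (2 * N%:R)^-1 :> R.
    by rewrite -natr1 mulrDl mul1r.
  by move: IH h; set y := _ / _; set z := (_)^-1; lra.
have := step N.
have -> : N%:R / (2 * N%:R) = 2^-1 :> R by field; rewrite gt_eqF.
have : F (mu * A + L) <= F (x0 + N%:R * (delta / 2)).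
  apply: fine_prob_le; [exact: measurable_series_le|exact: measurable_series_le|].
  move=> w /= hw; apply: le_trans hw _; rewrite lee_fin /x0.
  by move: NW; rewrite /W; lra.
by move: left right; rewrite -/x0; lra.
Qed.

End SeriesCdf.

(** * Asymptotics along the sequence of weights *)

Section Asymptotics.
Context {R : realType} {d : measure_display} {Omega : measurableType d}.
Variables (P : probability Omega R) (X : nat -> Omega -> R) (mu v p : R).
Hypothesis nX : square_noise P X mu v p.
Variables (a : nat -> nat -> R) (m : nat -> R) (C1 C2 : R).
Hypothesis am : forall n, (0 < n)%N -> forall j, 0 <= a n j <= m n.
Hypothesis m0 : m @ \oo --> 0.
Hypothesis C10 : 0 < C1.
Hypothesis C20 : 0 <= C2.
Hypothesis aC1 : forall n, (0 < n)%N -> exists J, C1 <= \sum_(j < J) a n j ^+ 2.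
Hypothesis aC2 : forall n, (0 < n)%N -> forall J, \sum_(j < J) a n j ^+ 2 <= C2.
Hypothesis aA : forall n, (0 < n)%N -> exists A, forall J, \sum_(j < J) a n j <= A.

Let mu0 : 0 <= mu. Proof. exact: (noise_mean2_ge0 _ _ _ _ _ nX). Qed.

Let npos : \forall n \near \oo, (0 < n)%N. Proof. by exists 1%N. Qed.

(** An energy above [delta] brings the distribution function at [x n] down to the null one at x n -
    delta / 2, up to 16 mu m n / delta. At the chosen thresholds this is a drop of at least q - q /
    4, against an allowed q / 4. *)
Lemma energy_small_of_undetectable (g : nat -> nat -> R) :
  (forall x : nat -> R, forall eps : R, 0 < eps -> \forall n \near \oo,
     series_cdf P X (a n) (fun=> 0) (x n) - series_cdf P X (a n) (g n) (x n) <= eps) ->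
  forall delta : R, 0 < delta ->
    \forall n \near \oo, forall J, energy (a n) (g n) J <= delta.
Proof.
move=> und delta d0.
have [q q0 incr] := series_cdf_increment _ _ _ _ _ nX C2 delta C20 d0.
(* These thresholds depend on the weights alone, so they are fixed before the indices with large
   energy are known; 0 is a filler at n = 0. *)
have /choice[x xP] : forall n, exists x, (0 < n)%N ->
    q <= series_cdf P X (a n) (fun=> 0) x -
         series_cdf P X (a n) (fun=> 0) (x - delta / 2).
  move=> n; have [n0|n0] := posnP n; first by exists 0; rewrite n0.
  have [x xq] := incr (a n) (fun j => proj1 (andP (am n n0 j))) (aC2 n n0) (aA n n0).
  by exists x.
have q4 : 0 < q / 4 by rewrite divr_gt0.
have c0 : 0 < q / 4 * delta / (16 * mu + 1).
  by rewrite divr_gt0 ?mulr_gt0// ltr_wpDl// mulr_ge0.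
have n1 := cvgr_lt _ m0 _ c0.
have n2 := und x (q / 4) q4.
near=> n => J; rewrite leNgt; apply/negP => /ltW dD.
have n0 : (0 < n)%N by near: n; exact: npos.
have h1 : m n < q / 4 * delta / (16 * mu + 1) by near: n; exact: n1.
have h2 : series_cdf P X (a n) (fun=> 0) (x n) -
    series_cdf P X (a n) (g n) (x n) <= q / 4 by near: n; exact: n2.
have mn0 : 0 <= m n by have /andP[u1 u2] := am n n0 0%N; exact: le_trans u1 u2.
have h3 := series_cdf_shift_le _ _ _ _ _ nX (a n) (g n) J (m n) delta (x n) (am n n0) d0 dD.
have h4 := xP n n0.
have : 16 * mu * m n / delta <= q / 4.
  rewrite ler_pdivrMr//; move: h1; rewrite ltr_pdivlMr; last by rewrite ltr_wpDl// mulr_ge0.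
  by lra.
by move: h3; set y := _ / delta; set z := delta / 2 in h4 *; lra.
Unshelve. all: by end_near.
Qed.

Lemma series_cdf_diff_cvg0 (h g : nat -> nat -> R) (x : nat -> R) (alpha : R) :
  0 < alpha ->
  (fun n => 1 - series_cdf P X (a n) (fun=> 0) (x n)) @ \oo --> alpha ->
  (forall delta : R, 0 < delta ->
    \forall n \near \oo, forall J, energy (a n) (g n) J <= delta) ->
  (fun n => series_cdf P X (a n) (h n) (x n) -
            series_cdf P X (a n) (fun j => h n j + g n j) (x n)) @ \oo --> 0.
Proof.
move=> al0 xal Dg; apply/cvgrPdist_le => eps e0.
(* The level converges to [alpha], hence exceeds alpha / 2 from some index on. *)
have al2 : 0 < alpha / 2 by rewrite divr_gt0.
have [delta [m1 [d0 m10 st]]] :=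
  series_cdf_stable _ _ _ _ _ nX C1 C2 (alpha / 2) eps C10 C20 al2 e0.
have n1 := cvgr_lt _ m0 _ m10.
have al3 : alpha / 2 < alpha by lra.
have n2 := cvgr_gt _ xal _ al3.
have n3 := Dg delta d0.
near=> n; rewrite sub0r normrN.
have n0 : (0 < n)%N by near: n; exact: npos.
apply: st.
- move=> j; have /andP[-> ajm] /= := am n n0 j; apply: (le_trans ajm).
  by apply: ltW; near: n; exact: n1.
- exact: aC1.
- exact: aC2.
- by near: n; exact: n3.
- by near: n; exact: n2.
Unshelve. all: by end_near.
Qed.

End Asymptotics.

(** * Integration against a measure with a density *)

Section Density.
Context {R : realType} {d : measure_display} {T : measurableType d}.
Variables (lam nu : {measure set T -> \bar R}) (phi : T -> R).
Hypothesis mphi : measurable_fun setT phi.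
Hypothesis phi0 : forall x, 0 <= phi x.
Hypothesis nuE : forall A, measurable A -> nu A = (\int[lam]_(x in A) (phi x)%:E)%E.
Import HBNNSimple.

Let integral_density_nnsfun (f : {nnsfun T >-> R}) :
  (\int[nu]_x (f x)%:E = \int[lam]_x ((f x)%:E * (phi x)%:E))%E.
Proof.
have term0 (r : R) (x : T) : (0 <= (r * \1_(f @^-1` [set r]) x)%:E)%E.
  by rewrite EFinM nnfun_muleindic_ge0.
under [LHS]eq_integral do rewrite fimfunE -fsumEFin//.
rewrite [LHS]ge0_integral_fsum//; last first.
  by move=> r; exact/measurable_EFinP/measurableT_comp.
under [RHS]eq_integral.
  move=> x _; rewrite fimfunE -fsumEFin// muleC ge0_mule_fsumr//.
  over.
rewrite [RHS]ge0_integral_fsum//; last 2 first.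
- move=> r; apply: emeasurable_funM; first exact/measurable_EFinP.
  exact/measurable_EFinP/measurableT_comp.
- by move=> r x _; rewrite mule_ge0// lee_fin.
apply: eq_fsbigr => r _.
have mr : measurable (f @^-1` [set r]) by [].
(* Empty level sets contribute 0; a nonempty one forces r >= 0, as pulling [r] out of the integral
   requires. *)
have [fr|fr] := pselect ((f @^-1` [set r]) = set0).
  by rewrite fr !integral0_eq// => x _; rewrite indicE in_set0 mulr0 ?mule0.
have r0 : 0 <= r.
  have /set0P[x /= <-] : f @^-1` [set r] != set0 by apply/eqP.
  exact: fun_ge0.
under [LHS]eq_integral do rewrite EFinM.
rewrite ge0_integralZl//; last first.
  by apply/measurable_EFinP; exact: measurable_indic.
rewrite integral_indic// setIT nuE//.
under [RHS]eq_integral do rewrite EFinM muleCA.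
rewrite ge0_integralZl//; last 2 first.
- apply: emeasurable_funM; first exact/measurable_EFinP.
  by apply/measurable_EFinP; exact: measurable_indic.
- by move=> x _; rewrite mule_ge0// lee_fin.
congr (_ * _)%E; rewrite integral_mkcond; apply: eq_integral => x _.
rewrite patchE indicE; case: ifP => _ /=; first by rewrite mule1.
by rewrite mule0.
Qed.

(** Linearity gives the identity for simple functions, and monotone convergence extends it. *)
Lemma ge0_integral_density (f : T -> \bar R) :
  measurable_fun setT f -> (forall x, 0 <= f x)%E ->
  (\int[nu]_x f x = \int[lam]_x (f x * (phi x)%:E))%E.
Proof.
move=> mf f0.
pose f_ := nnsfun_approx measurableT mf.
transitivity (lim (\int[nu]_x (f_ n x)%:E @[n --> \oo])%E).
  rewrite -monotone_convergence//=.
  - apply: eq_integral => ? /[!inE] xD; apply/esym/cvg_lim => //=.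
    exact: cvg_nnsfun_approx.
  - by move=> n; exact/measurable_EFinP/measurable_funTS.
  - by move=> n ? _; rewrite lee_fin.
  - by move=> ? _ ? ? mn; rewrite lee_fin; exact/lefP/nd_nnsfun_approx.
transitivity (lim (\int[lam]_x ((f_ n x)%:E * (phi x)%:E) @[n --> \oo])%E).
  by apply: congr_lim; apply/funext => n /=; exact: integral_density_nnsfun.
rewrite -monotone_convergence//=.
- apply: eq_integral => x _; apply/cvg_lim => //=.
  apply: cvgeZr => //; exact: cvg_nnsfun_approx.
- move=> n; apply: emeasurable_funM; first exact/measurable_EFinP/measurable_funTS.
  exact/measurable_EFinP.
- by move=> n x _; rewrite mule_ge0// lee_fin.
- move=> x _ k l kl; apply: lee_wpmul2r; first by rewrite lee_fin.
  by rewrite lee_fin; exact/lefP/nd_nnsfun_approx.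
Qed.

End Density.

(** * Moments and mass of the standard normal law *)

Section NormalMoments.
Context {R : realType}.
Local Notation lam := (@lebesgue_measure R).
Local Notation nu := (@normal_prob R 0 1).

(** An interval and its mirror image have the same length, and lengths of intervals determine
    Lebesgue measure. *)
Lemma lebesgue_measure_opp (A : set R) : measurable A ->
  lam (-%R @^-1` A) = lam A.
Proof.
have mopp : measurable_fun setT (-%R : measurableTypeR R -> measurableTypeR R).
  by apply: (@continuous_measurable_fun R -%R); exact: opp_continuous.
move=> mA.
have h := @lebesgue_measure_unique R
  (pushforward lam (-%R : measurableTypeR R -> measurableTypeR R)).
apply/esym; apply: (h mopp) => //.
move=> _ [[a b] _ <-] /=; rewrite /pushforward.
have -> : -%R @^-1` [set` `]a, b]] = [set` `[- b, - a[] :> set R.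
  by apply/seteqP; split => x /=; rewrite !in_itv /=; lra.
rewrite !lebesgue_measure_itv /= !lte_fin ltrN2 opprK -!EFinD.
by case: ifP => // _; congr (_%:E); ring.
Qed.

Lemma normal_prob_opp (A : set R) : measurable A -> nu (-%R @^-1` A) = nu A.
Proof.
have mopp : measurable_fun setT (-%R : measurableTypeR R -> measurableTypeR R).
  by apply: (@continuous_measurable_fun R -%R); exact: opp_continuous.
move=> mA; rewrite /normal_prob.
transitivity (\int[pushforward lam (-%R : measurableTypeR R -> measurableTypeR R)]_(x in A)
   (normal_pdf 0 1 x)%:E)%E; last first.
  by apply: eq_measure_integral => B mB _; exact: lebesgue_measure_opp.
rewrite ge0_integral_pushforward//.
- apply: eq_integral => x _ /=; rewrite /normal_pdf oner_eq0.
  by rewrite /normal_fun !subr0 sqrrN.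
- apply/measurable_EFinP/measurable_funTS; exact: measurable_normal_pdf.
- by move=> x _; rewrite lee_fin normal_pdf_ge0.
Qed.

(** A multiple of the normal density of variance 2 dominates the integrand. With y = x^2 / 4 the
    comparison reduces to 16 y^2 <= 64 exp(y), which follows from y / 2 <= exp(y / 2). *)
Lemma integrable_normal_pow4 : nu.-integrable setT (fun x : R => (x ^+ 4)%:E).
Proof.
have mx4 : measurable_fun setT (fun x : R => x ^+ 4) by exact: measurable_funX.
apply/integrableP; split; first exact/measurable_EFinP.
rewrite (@ge0_integral_density R _ _ lam nu (normal_pdf 0 1))//; last 3 first.
- exact: measurable_normal_pdf.
- by move=> x; exact: normal_pdf_ge0.
- by apply: measurableT_comp => //; exact/measurable_EFinP.
pose s : R := Num.sqrt 2.
have s2 : s ^+ 2 = 2 by rewrite sqr_sqrtr.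
have s0 : s != 0 by rewrite sqrtr_eq0 -ltNge.
pose c : R := 64 * normal_peak 1 / normal_peak s.
have ps0 := normal_peak_gt0 s0.
have p10 : 0 < normal_peak 1 :> R by rewrite normal_peak_gt0.
have c0 : 0 <= c by rewrite divr_ge0 ?mulr_ge0// ltW.
apply: (@le_lt_trans _ _ (\int[lam]_x (c%:E * (normal_pdf 0 s x)%:E))%E).
  apply: ge0_le_integral => //.
  - by move=> x _; rewrite mule_ge0// lee_fin normal_pdf_ge0.
  - apply: emeasurable_funM; last by apply/measurable_EFinP; exact: measurable_normal_pdf.
    by apply: measurableT_comp => //; exact/measurable_EFinP.
  - apply: emeasurable_funM => //; apply/measurable_EFinP; exact: measurable_normal_pdf.
  move=> x _; rewrite abse_EFin -!EFinM lee_fin ger0_norm; last first.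
    by rewrite (exprM x 2 2) sqr_ge0.
  have e4 : 2 *+ 2 = 4 :> R by rewrite -mulr_natr; ring.
  rewrite !normal_pdfE ?oner_eq0// /normal_fun !subr0 s2 expr1n e4.
  have -> : c * (normal_peak s * expR (- x ^+ 2 / 4)) =
      normal_peak 1 * (64 * expR (- x ^+ 2 / 4)).
    by rewrite /c; field; rewrite gt_eqF.
  rewrite mulrCA ler_pM2l//.
  have -> : - x ^+ 2 / 2 = - x ^+ 2 / 4 + - (x ^+ 2 / 4) by lra.
  rewrite expRD mulrCA mulrC ler_pM2r ?expR_gt0// expRN.
  rewrite ler_pdivrMr ?expR_gt0//.
  set y := x ^+ 2 / 4.
  have y0 : 0 <= y by rewrite divr_ge0 ?sqr_ge0.
  have zy : x ^+ 2 = 4 * y by rewrite /y; lra.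
  have -> : x ^+ 4 = 16 * y ^+ 2 by rewrite (exprM x 2 2) zy; ring.
  have -> : expR y = expR (y / 2) ^+ 2 by rewrite expr2 -expRD; congr expR; lra.
  by have := expR_ge1Dx (y / 2); nra.
rewrite ge0_integralZl//; last 2 first.
- apply/measurable_EFinP; exact: measurable_normal_pdf.
- by move=> x _; rewrite lee_fin normal_pdf_ge0.
by rewrite integral_normal_pdf mule1 ltry.
Qed.

Lemma normal_prob_itv_gt0 (a b : R) : 0 <= a -> a < b -> b <= 3 ->
  (0 < nu `[a, b])%E.
Proof.
(* On [0, 3] the exponent - x^2 / 2 is at least - 9 / 2, above - 5. *)
move=> a0 ab b3; pose c : R := normal_peak 1 * expR (- 5).
have c0 : 0 < c by rewrite mulr_gt0 ?expR_gt0// normal_peak_gt0// oner_eq0.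
apply: (@lt_le_trans _ _ (\int[lam]_(x in `[a, b]) c%:E)%E).
  rewrite integral_cst//= lebesgue_measure_itv/= lte_fin ab -EFinD -EFinM lte_fin.
  by rewrite mulr_gt0// subr_gt0.
apply: ge0_le_integral => //.
- by move=> x _; rewrite lee_fin ltW.
- apply/measurable_EFinP/measurable_funTS; exact: measurable_normal_pdf.
move=> x /=; rewrite in_itv /= => /andP[ax xb].
rewrite lee_fin normal_pdfE ?oner_eq0// /c ler_pM2l ?normal_peak_gt0 ?oner_eq0//.
rewrite /normal_fun ler_expR subr0 expr1n.
have : x ^+ 2 <= 9 by nra.
by rewrite -mulr_natr; lra.
Qed.

End NormalMoments.

(** * Standard normal variables as noise *)

Section NormalNoise.
Context {R : realType} {d : measure_display} {Omega : measurableType d}.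
Variables (P : probability Omega R).
Local Notation nu := (@normal_prob R 0 1).

Lemma expectation_law (Y : Omega -> R) (f : R -> R) : measurable_fun setT Y ->
  (forall A : set R, measurable A -> P (Y @^-1` A) = nu A) ->
  measurable_fun setT f -> nu.-integrable setT (EFin \o f) ->
  P.-integrable setT (EFin \o (fun w => f (Y w))) /\
  Rintegral P setT (fun w => f (Y w)) = Rintegral nu setT f.
Proof.
move=> mY hY mf inu.
pose Y' : Omega -> measurableTypeR R := Y.
have mY' : measurable_fun setT Y' by exact: mY.
have mEf : measurable_fun setT (EFin \o f) by exact/measurable_EFinP.
have iP : P.-integrable setT (EFin \o (fun w => f (Y w))).
  apply/integrableP; split.
    by apply/measurable_EFinP; exact: measurableT_comp.
  have /integrableP[_] := inu; apply: le_lt_trans.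
  rewrite (_ : (\int[nu]_x `|(EFin \o f) x|)%E =
      (\int[pushforward P Y']_x `|(EFin \o f) x|)%E); last first.
    by apply: (@eq_measure_integral _ (measurableTypeR R)) => A mA _; exact/esym/hY.
  rewrite (@ge0_integral_pushforward _ _ _ _ _ _ mY' P setT)//.
  exact: measurableT_comp.
split=> //; rewrite /Rintegral; congr fine.
rewrite (_ : (\int[nu]_x (f x)%:E)%E = (\int[pushforward P Y']_x (f x)%:E)%E); last first.
  by apply: (@eq_measure_integral _ (measurableTypeR R)) => A mA _; exact/esym/hY.
by rewrite (@integral_pushforward _ _ _ _ _ _ mY' P setT (EFin \o f) mEf iP).
Qed.

Lemma integrable_normal_dom (f : R -> R) : measurable_fun setT f ->
  (forall x, `|f x| <= 1 + x ^+ 4) -> nu.-integrable setT (EFin \o f).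
Proof.
move=> mf fx.
have i14 : nu.-integrable setT (EFin \o (fun x : R => 1 + x ^+ 4)).
  apply: (@integrableD _ (measurableTypeR R) R nu setT measurableT
    (EFin \o cst 1) _ _ integrable_normal_pow4).
  exact: finite_measure_integrable_cst.
apply: le_integrable i14 => //; first exact/measurable_EFinP.
move=> x _ /=; rewrite lee_fin (le_trans (fx x))// ler_norm//.
Qed.

(** By symmetry of the law, the mean equals its own opposite. *)
Lemma normal_mean0 : Rintegral nu setT (fun x : R => x) = 0.
Proof.
pose opp' : measurableTypeR R -> measurableTypeR R := -%R.
have mopp : measurable_fun setT opp'.
  by apply: (@continuous_measurable_fun R -%R); exact: opp_continuous.
have mE : measurable_fun setT (EFin : R -> \bar R) by exact/measurable_EFinP.
have i1 : nu.-integrable setT (EFin \o (-%R : R -> R)).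
  apply: integrable_normal_dom => // x; rewrite normrN ler_norml.
  by apply/andP; split; have := sqr_ge0 (x ^+ 2 - 2^-1); have := sqr_ge0 (x - 2^-1);
    have := sqr_ge0 (x + 2^-1); rewrite (exprM x 2 2); nra.
have i0 : nu.-integrable setT (EFin \o (fun x : R => x)).
  have -> : (EFin \o (fun x : R => x)) = (-%E \o (EFin \o -%R)).
    by apply/funext => x /=; rewrite opprK.
  exact: integrableN.
have : (\int[nu]_x (x%:E) = \int[nu]_x ((- x)%:E))%E.
  have -> : (\int[nu]_x (x%:E) = \int[pushforward nu opp']_x (x%:E))%E.
    by apply: (@eq_measure_integral _ (measurableTypeR R)) => A mA _; exact/esym/normal_prob_opp.
  by rewrite (@integral_pushforward _ _ _ _ _ _ mopp nu setT EFin mE i1).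
move=> h.
have : Rintegral nu setT (fun x : R => x) = Rintegral nu setT (fun x : R => -1 * x).
  by rewrite /Rintegral h; congr fine; apply: eq_integral => x _; rewrite mulN1r.
rewrite RintegralZl//; lra.
Qed.

(** The variables are renumbered from 0, and [mu] and [v] are kept as integrals under the normal
    law. *)
Lemma iid_std_normal_square_noise (xi : nat -> Omega -> R) :
  iid_std_normal P xi ->
  exists mu v p, square_noise P (fun j => xi j.+1) mu v p.
Proof.
move=> [mxi lxi ixi].
have bx2 (x : R) : 0 <= x ^+ 2 <= 1 + x ^+ 4.
  by rewrite sqr_ge0 (exprM x 2 2); have := sqr_ge0 (x ^+ 2 - 2^-1); nra.
have m2 : measurable_fun setT (fun x : R => x ^+ 2) by exact: measurable_funX.
have m4 : measurable_fun setT (fun x : R => x ^+ 4) by exact: measurable_funX.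
have i1 : nu.-integrable setT (EFin \o (fun x : R => x)).
  apply: integrable_normal_dom => // x; rewrite ler_norml.
  by apply/andP; split; have := sqr_ge0 (x ^+ 2 - 2^-1); have := sqr_ge0 (x - 2^-1);
    have := sqr_ge0 (x + 2^-1); rewrite (exprM x 2 2); nra.
have i2 : nu.-integrable setT (EFin \o (fun x : R => x ^+ 2)).
  by apply: integrable_normal_dom => // x; have /andP[? ?] := bx2 x; rewrite ger0_norm.
have i4 : nu.-integrable setT (EFin \o (fun x : R => x ^+ 4)).
  exact: integrable_normal_pow4.
pose mu := Rintegral nu setT (fun x : R => x ^+ 2).
pose v := Rintegral nu setT (fun x : R => (x ^+ 2 - mu) ^+ 2).
have mv : measurable_fun setT (fun x : R => (x ^+ 2 - mu) ^+ 2).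
  by apply: measurable_funX; exact: measurable_funB.
have iv : nu.-integrable setT (EFin \o (fun x : R => (x ^+ 2 - mu) ^+ 2)).
  have -> : EFin \o (fun x : R => (x ^+ 2 - mu) ^+ 2) =
     EFin \o (fun x : R => (x ^+ 4 + (- (2 * mu)) * x ^+ 2) + mu ^+ 2).
    by apply/funext => x /=; congr EFin; ring.
  have iz := @integrableZl _ (measurableTypeR R) R nu setT measurableT (- (2 * mu)) _ i2.
  have iz2 := @integrableD _ (measurableTypeR R) R nu setT measurableT _ _ i4 iz.
  have ic : nu.-integrable setT (EFin \o cst (mu ^+ 2)).
    exact: finite_measure_integrable_cst.
  exact: (@integrableD _ (measurableTypeR R) R nu setT measurableT _ _ iz2 ic).
(* Squaring maps [0, 1] into [0, 1] and [2, 3] into [4, 9]. *)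
pose p := Num.min (fine (nu `[0, 1])) (fine (nu `[2, 3])).
have law j s := expectation_law _ s (mxi j.+1 isT) (fun A mA => lxi j.+1 A isT mA).
exists mu, v, p; split.
- by move=> j; exact: mxi.
- move=> J B uJ mB.
  have uJ' : uniq (map S J) by rewrite map_inj_uniq//; exact: succn_inj.
  have pos j : j \in map S J -> (1 <= j)%N by move=> /mapP[i _ ->].
  have := ixi (map S J) (fun j => B j.-1) uJ' pos (fun j => mB j.-1).
  rewrite big_map => <-; congr (P _); apply/seteqP; split => w hw j /=.
    by move=> /mapP[i iJ ->] /=; exact: hw.
  by move=> jJ; apply: (hw j.+1); rewrite /= map_f.
- by move=> j; have [] := law j _ (@measurable_id _ _ _) i1.
- by move=> j; have [] := law j _ m2 i2.
- by move=> j; have [] := law j _ m4 i4.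
- move=> j; have [_] := law j _ (@measurable_id _ _ _) i1.
  by move=> ->; exact: normal_mean0.
- by move=> j; have [] := law j _ m2 i2.
- by move=> j; have [] := law j _ mv iv.
- have pos (a b : R) : 0 <= a -> a < b -> b <= 3 -> 0 < fine (nu `[a, b]).
    move=> a0 ab b3; apply: fine_gt0; apply/andP; split.
      exact: normal_prob_itv_gt0.
    apply: le_lt_trans (ltry 1).
    by apply: (@probability_le1 _ (measurableTypeR R) R nu); exact: measurable_itv.
  by rewrite lt_min; apply/andP; split; apply: pos => //; lra.
- move=> j; rewrite ge_min; apply/orP; left.
  rewrite -(lxi j.+1)//; apply: fine_prob_le.
  + by apply: preimage_measurableT; [exact: mxi|exact: measurable_itv].
  + have -> : [set w | 0 <= xi j.+1 w ^+ 2 <= 1] = (fun w => xi j.+1 w ^+ 2) @^-1` `[0, 1].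
      by apply/seteqP; split => w /=; rewrite in_itv.
    by apply: preimage_measurableT => //; apply: measurable_funX; exact: mxi.
  + by move=> w /=; rewrite in_itv /= sqr_ge0 /= => /andP[? ?]; nra.
- move=> j; rewrite ge_min; apply/orP; right.
  rewrite -(lxi j.+1)//; apply: fine_prob_le.
  + by apply: preimage_measurableT; [exact: mxi|exact: measurable_itv].
  + have -> : [set w | 4 <= xi j.+1 w ^+ 2 <= 9] = (fun w => xi j.+1 w ^+ 2) @^-1` `[4, 9].
      by apply/seteqP; split => w /=; rewrite in_itv.
    by apply: preimage_measurableT => //; apply: measurable_funX; exact: mxi.
  + by move=> w /=; rewrite in_itv /= => /andP[? ?]; apply/andP; split; nra.
Qed.

End NormalNoise.

(** * Fourier coefficients, series and powers *)

Lemma integrable_mul_L2 (R : realType) (f g : R -> R) : L2_01 f -> L2_01 g ->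
  lebesgue_measure.-integrable (`[0, 1] : set R) (EFin \o (fun x => f x * g x)).
Proof.
move=> [mf if2] [mg ig2].
have i := @integrableD _ (measurableTypeR R) R lebesgue_measure `[0, 1]
  (measurable_itv _) _ _ if2 ig2.
apply: le_integrable i => //.
  by apply/measurable_EFinP; exact: measurable_funM.
move=> x _ /=; rewrite lee_fin [leRHS]ger0_norm ?addr_ge0 ?sqr_ge0// ler_norml.
have := sqr_ge0 (f x + g x); have := sqr_ge0 (f x - g x).
have := sqr_ge0 (f x); have := sqr_ge0 (g x).
by move=> *; apply/andP; split; nra.
Qed.

Lemma coefD (R : realType) (phi : nat -> R -> R) (f g : R -> R) (j : nat) :
  L2_01 (phi j) -> L2_01 f -> L2_01 g ->
  coef phi (f \+ g) j = coef phi f j + coef phi g j.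
Proof.
move=> hp hf hg; rewrite /coef /inner01 -RintegralD//; last 2 first.
- exact: integrable_mul_L2.
- exact: integrable_mul_L2.
by apply: eq_Rintegral => x _; rewrite mulrDl.
Qed.

Lemma nneseries1_leP (R : realType) (u : nat -> R) (x : R) :
  (forall j, (1 <= j)%N -> 0 <= u j) ->
  (\sum_(1 <= j <oo) (u j)%:E <= x%:E)%E <-> forall J, \sum_(j < J) u j.+1 <= x.
Proof.
move=> u0.
have t0 n : (1 <= n)%N -> true -> (0 <= (u n)%:E)%E by move=> n1 _; rewrite lee_fin u0.
have qE J : (\sum_(1 <= j < J.+1) (u j)%:E)%E = (\sum_(j < J) u j.+1)%:E.
  by rewrite sumEFin big_add1 /= big_mkord.
split=> [le J|le].
  by rewrite -lee_fin -qE; apply: le_trans le; exact: nneseries_lim_ge.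
apply: lime_le; first exact: is_cvg_nneseries.
exists 1%N => // -[//|J] _ /=; by rewrite qE lee_fin.
Qed.

Lemma powR_nat_cvgy (R : realType) (e M : R) : 0 < e -> 0 < M ->
  \forall n \near \oo, M <= (n%:R : R) `^ e.
Proof.
move=> e0 M0; have n1 := nbhs_infty_ger (M `^ e^-1).
near=> n.
have -> : M = (M `^ e^-1) `^ e by rewrite -powRrM mulVf ?gt_eqF// powRr1// ltW.
apply: (ge0_ler_powR (ltW e0)); [by rewrite nnegrE powR_ge0|by rewrite nnegrE|].
by near: n; exact: n1.
Unshelve. all: by end_near.
Qed.

(** * Bounds on the rescaled weights *)

Section Weights.
Context {R : realType}.
Variables (sigma r : R) (kappa2 : nat -> nat -> R).
Hypothesis sigma0 : 0 < sigma.
Hypothesis r12 : 0 < r < 2^-1.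
Hypothesis kappa0 : forall n j, (1 <= j)%N -> 0 <= kappa2 n j.
Hypothesis hA1 : A1 kappa2.
Hypothesis hA2 : A2 sigma kappa2.
Hypothesis hA3 : A3 r kappa2.
Hypothesis hA5 : A5 kappa2.

(** [kn] is the integer part of a supremum, so kn + 1 lies outside the defining set; this is the
    lower bound on the sum of the first kn weights. *)
Lemma kn_spec n (x : R) : 0 < x -> rho kappa2 n = x%:E ->
  (1 <= kn kappa2 n)%N /\ x / 2 < \sum_(j < kn kappa2 n) kappa2 n j.+1.
Proof.
move=> x0 rx.
pose K := [set k : nat | ((\sum_(1 <= j < k) kappa2 n j)%:E <=
                      rho kappa2 n * (2^-1)%:E)%E].
(* The defining sum stops before its index: membership of k + 1 concerns the first k weights. *)
have KE k : K k.+1 <-> \sum_(j < k) kappa2 n j.+1 <= x / 2.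
  by rewrite /K /= rx -EFinM lee_fin big_add1 big_mkord.
(* Some partial sum passes half of the positive total. This bounds the set, so its [sup] is a
   genuine supremum and not a default value. *)
have [J0 J0x] : exists J, x / 2 < \sum_(j < J) kappa2 n j.+1.
  apply: contrapT => /forallNP h.
  have : (rho kappa2 n <= (x / 2)%:E)%E.
    apply/nneseries1_leP => [j j1|J]; first exact: kappa0.
    by rewrite leNgt; apply/negP; exact: h.
  by rewrite rx lee_fin; lra.
pose A := [set (k%:R : R) | k in K].
have A1 : A 1.
  by exists 1%N => //; apply/KE; rewrite big_ord0 divr_ge0// ltW.
have supA : has_sup A.
  split; first by exists 1.
  exists J0.+1%:R => _ [[|k] Kk <-]; first by rewrite ler_nat.
  rewrite ler_nat ltnS leqNgt; apply/negP => J0k.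
  have := proj1 (KE k) Kk; apply/negP; rewrite -ltNge.
  apply: lt_le_trans J0x _.
  rewrite -!(big_mkord xpredT (fun j => kappa2 n j.+1)).
  rewrite (big_cat_nat (leq0n J0) (ltnW J0k)) /= lerDl.
  by apply: sumr_ge0 => j _; exact: kappa0.
have s1 : 1 <= sup A by exact: sup_upper_bound.
have knE : kn kappa2 n = Num.truncn (sup A) by [].
split; first by rewrite knE truncn_ge_nat// (le_trans _ s1).
rewrite ltNge; apply/negP => /KE Kk.
have : (kn kappa2 n).+1%:R <= sup A by apply: sup_upper_bound => //; exists (kn kappa2 n).+1.
by apply/negP; rewrite -ltNge knE truncnS_gt.
Qed.

Lemma rho_fin n : (0 < n)%N -> exists2 x : R, 0 < x & rho kappa2 n = x%:E.
Proof.
move=> n0; have [c1 [c2 [c10 [c20 /(_ n n0)[lo up]]]]] := hA3.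
have n0' : 0 < n%:R `^ (- (2 * r)) :> R by apply: powR_gt0; rewrite ltr0n.
have fr : rho kappa2 n \is a fin_num.
  rewrite ge0_fin_numE; first exact: le_lt_trans up (ltry _).
  by apply: le_trans lo; rewrite lee_fin ltW// mulr_gt0.
exists (fine (rho kappa2 n)); last by rewrite fineK.
by move: lo; rewrite -(fineK fr) lee_fin; apply: lt_le_trans; rewrite mulr_gt0.
Qed.

Lemma sum_kappa4_lt : exists2 C2 : R, 0 <= C2 & forall n J, (0 < n)%N ->
  \sum_(j < J) (n%:R / sigma ^+ 2 * kappa2 n j.+1) ^+ 2 <= C2.
Proof.
have [C1 [C2 [C10 hC]]] := hA2; exists C2.
  have [h1 h2] := hC 1%N isT.
  by have := lt_trans h1 h2; rewrite lte_fin; lra.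
move=> n J n0; have [_ up] := hC n n0.
have s4 : 0 < sigma ^- 4 * n%:R ^+ 2 by rewrite mulr_gt0 ?invr_gt0 ?exprn_gt0// ltr0n.
have -> : \sum_(j < J) (n%:R / sigma ^+ 2 * kappa2 n j.+1) ^+ 2 =
    sigma ^- 4 * n%:R ^+ 2 * \sum_(j < J) kappa2 n j.+1 ^+ 2.
  rewrite big_distrr /=; apply: eq_bigr => j _.
  by rewrite -[sigma ^- 4]exprVn; field; rewrite gt_eqF.
rewrite -lee_fin; apply/ltW; apply: le_lt_trans up.
rewrite EFinM; apply: lee_wpmul2l; first by rewrite lee_fin ltW.
have -> : (\sum_(j < J) kappa2 n j.+1 ^+ 2)%:E =
    (\sum_(1 <= j < J.+1) (kappa2 n j ^+ 2)%:E)%E.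
  by rewrite sumEFin big_add1 big_mkord.
by apply: nneseries_lim_ge => j _ _; rewrite lee_fin sqr_ge0.
Qed.

Lemma sum_kappa4_gt : exists2 C1 : R, 0 < C1 & forall n, (0 < n)%N ->
  exists J, C1 <= \sum_(j < J) (n%:R / sigma ^+ 2 * kappa2 n j.+1) ^+ 2.
Proof.
have [C1 [C2 [C10 hC]]] := hA2; exists C1 => // n n0; have [lo _] := hC n n0.
have s4 : 0 < sigma ^- 4 * n%:R ^+ 2 by rewrite mulr_gt0 ?invr_gt0 ?exprn_gt0// ltr0n.
have sE J : \sum_(j < J) (n%:R / sigma ^+ 2 * kappa2 n j.+1) ^+ 2 =
    sigma ^- 4 * n%:R ^+ 2 * \sum_(j < J) kappa2 n j.+1 ^+ 2.
  rewrite big_distrr /=; apply: eq_bigr => j _.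
  by rewrite -[sigma ^- 4]exprVn; field; rewrite gt_eqF.
apply: contrapT => /forallNP h; move: lo; apply/negP; rewrite -leNgt.
rewrite muleC -lee_pdivlMr// -EFinM.
apply/(@nneseries1_leP R (fun j => kappa2 n j ^+ 2)) => [j _|J]; first exact: sqr_ge0.
rewrite ler_pdivlMr// mulrC -sE leNgt; apply/negP => /ltW; exact: h.
Qed.

Lemma sum_kappa2_bounded n : (0 < n)%N ->
  exists A, forall J, \sum_(j < J) (n%:R / sigma ^+ 2 * kappa2 n j.+1) <= A.
Proof.
move=> n0; have [x x0 rx] := rho_fin n n0.
exists (n%:R / sigma ^+ 2 * x) => J; rewrite -big_distrr /= ler_wpM2l//.
  by rewrite divr_ge0// sqr_ge0.
by move: J; apply/nneseries1_leP; [move=> j; exact: kappa0|rewrite -rx].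
Qed.

(* With [k] for [kn]: [rho / 2 < k * kappa_1^2] and
   [k * kappa_k^4 <= \sum_j kappa_j^4 = O(n^-2)], hence by (A5)
   [kappa_1^2 * rho = O(n^-2)], and [n * rho] tends to infinity by (A3). *)
Lemma weight_cvg0 : (fun n => n%:R / sigma ^+ 2 * kappa2 n 1%N) @ \oo --> 0.
Proof.
have [C2 C20 hC2] := sum_kappa4_lt.
have [c1 [c2 [c10 [c20 hr]]]] := hA3.
have [[c [C [c0 [C0 hC]]]] _] := hA5.
pose a n j := n%:R / sigma ^+ 2 * kappa2 n j.+1.
(* Growth exponent of n rho, positive because r < 1/2. *)
pose e := 1 - 2 * r; have e0 : 0 < e by have /andP[] := r12; rewrite /e; lra.
pose Q := 2 * C ^+ 2 * C2 * sigma ^+ 2 / c1.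
have Q0 : 0 <= Q by rewrite divr_ge0 ?mulr_ge0// ?sqr_ge0// ltW.
have bound n : (0 < n)%N -> a n 0%N * n%:R `^ e <= Q.
  move=> n0; have n0' : 0 < n%:R :> R by rewrite ltr0n.
  have [x x0 rx] := rho_fin n n0; have [k1 kx] := kn_spec n x x0 rx.
  have /andP[_ k1C] := hC n n0.
  (* With kn written as k + 1, [a n k] is the rescaled weight of 1-based index kn. *)
  move: k1 kx k1C; rewrite /kappan2; case: (kn kappa2 n) => // k _ kx k1C.
  have s0 : 0 <= n%:R / sigma ^+ 2 by rewrite divr_ge0// sqr_ge0.
  have a0 j : 0 <= a n j by rewrite mulr_ge0// kappa0.
  have ak : a n 0%N <= C * a n k.
    by rewrite /a mulrCA ler_wpM2l.
  have h1 : n%:R / sigma ^+ 2 * (x / 2) <= k.+1%:R * a n 0%N.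
    apply: le_trans (_ : _ <= \sum_(j < k.+1) a n j) _.
      by rewrite -big_distrr /= ler_wpM2l// ltW.
    have -> : k.+1%:R * a n 0%N = \sum_(j < k.+1) a n 0%N.
      by rewrite sumr_const card_ord mulr_natl.
    by apply: ler_sum => j _; rewrite /a ler_wpM2l// hA1.
  have h2 : k.+1%:R * a n k ^+ 2 <= C2.
    apply: le_trans (hC2 n k.+1 n0).
    have -> : k.+1%:R * a n k ^+ 2 = \sum_(j < k.+1) a n k ^+ 2.
      by rewrite sumr_const card_ord mulr_natl.
    apply: ler_sum => j _.
    rewrite ler_pXn2r ?nnegrE; [|by []|exact: a0|exact: (a0 j)].
    by rewrite /a ler_wpM2l// hA1// ltnS -ltnS.
  have h3 : a n 0%N * (n%:R / sigma ^+ 2 * (x / 2)) <= C ^+ 2 * C2.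
    apply: (@le_trans _ _ (k.+1%:R * a n 0%N ^+ 2)).
      have -> : k.+1%:R * a n 0%N ^+ 2 = a n 0%N * (k.+1%:R * a n 0%N) by ring.
      by rewrite ler_wpM2l.
    apply: (@le_trans _ _ (C ^+ 2 * (k.+1%:R * a n k ^+ 2))); last first.
      by apply: ler_wpM2l; [exact: sqr_ge0|exact: h2].
    have -> : C ^+ 2 * (k.+1%:R * a n k ^+ 2) = k.+1%:R * (C * a n k) ^+ 2 by ring.
    rewrite ler_wpM2l// ler_pXn2r ?nnegrE//.
    by rewrite mulr_ge0// ltW.
  have [lo _] := hr n n0; move: lo; rewrite rx lee_fin => lo.
  have -> : n%:R `^ e = n%:R * n%:R `^ (- (2 * r)).
    rewrite /e powRD ?powRr1 ?ler0n//.
    by rewrite gt_eqF ?implybT// -/e.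
  have s2 : 0 < sigma ^+ 2 by rewrite exprn_gt0.
  rewrite /Q ler_pdivlMr//.
  have h4 : a n 0%N * n%:R * x <= 2 * C ^+ 2 * C2 * sigma ^+ 2.
    move: h3; have -> : a n 0%N * (n%:R / sigma ^+ 2 * (x / 2)) =
       a n 0%N * n%:R * x / (2 * sigma ^+ 2) by field; rewrite gt_eqF.
    by rewrite ler_pdivrMr ?mulr_gt0//; lra.
  apply: le_trans h4.
  have -> : a n 0%N * (n%:R * n%:R `^ (- (2 * r))) * c1 =
     a n 0%N * n%:R * (c1 * n%:R `^ (- (2 * r))) by ring.
  by rewrite ler_wpM2l// mulr_ge0// ltW.
apply/cvgrPdist_le => eps eps0.
have M0 : 0 < (Q + 1) / eps by rewrite divr_gt0//; lra.
have n1 := powR_nat_cvgy _ e _ e0 M0.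
have npos : \forall n \near \oo, (0 < n)%N by exists 1%N.
near=> n.
have n0 : (0 < n)%N by near: n; exact: npos.
have h1 : (Q + 1) / eps <= n%:R `^ e by near: n; exact: n1.
have := bound n n0; rewrite -/(a n 0%N) sub0r normrN => h2.
have an0 : 0 <= a n 0%N by rewrite mulr_ge0 ?kappa0// divr_ge0 ?sqr_ge0.
rewrite ger0_norm// leNgt; apply/negP => h3.
move: h1; rewrite ler_pdivrMr// => h1.
have : 0 < n%:R `^ e :> R by apply: powR_gt0; rewrite ltr0n.
by nra.
Unshelve. all: by end_near.
Qed.

End Weights.

(** * The test statistic as a quadratic form *)

Section Statistic.
Context {R : realType} {d : measure_display} {Omega : measurableType d}.
Variables (P : probability Omega R) (sigma : R) (kappa2 : nat -> nat -> R).
Variables (xi : nat -> Omega -> R) (n : nat) (s : R).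
Hypothesis sigma0 : 0 < sigma.
Hypothesis n0 : (0 < n)%N.
Hypothesis kappa0 : forall j, (1 <= j)%N -> 0 <= kappa2 n j.
Hypothesis rhoE : rho kappa2 n = s%:E.

Let a j := n%:R / sigma ^+ 2 * kappa2 n j.+1.
Let X j := xi j.+1.

(** The inequality T_n <= t is multiplied by (n / sigma^2)^2: one factor normalises the
    observations, the other the weights. The centring term becomes (n / sigma^2) rho. *)
Definition threshold (sg : R) (k : nat) (rh t : R) : R :=
  (k%:R / sg ^+ 2) ^+ 2 * t + k%:R / sg ^+ 2 * rh.

(** Coefficients in units of the noise level sigma / sqrt n, renumbered from 0. *)
Definition signal (sg : R) (k : nat) (theta : nat -> R) (j : nat) : R :=
  theta j.+1 * (Num.sqrt k%:R / sg).

Let N0 : 0 < n%:R / sigma ^+ 2.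
Proof. by rewrite divr_gt0 ?exprn_gt0// ltr0n. Qed.

(** Both inequalities are tested on partial sums, which are proportional; divergent series are
    thereby covered. *)
Lemma Tstat_le theta (t : R) (w : Omega) :
  (Tstat sigma kappa2 xi theta n w <= t%:E)%E <->
  (quad_series X a (signal sigma n theta) w <= (threshold sigma n s t)%:E)%E.
Proof.
have n0' : 0 < n%:R :> R by rewrite ltr0n.
have sn0 : 0 < Num.sqrt n%:R :> R by rewrite sqrtr_gt0.
have snE : (Num.sqrt n%:R) ^+ 2 = n%:R :> R by rewrite sqr_sqrtr// ltW.
have a0 j : 0 <= a j by rewrite mulr_ge0 ?kappa0// ltW.
pose u j := kappa2 n j * (theta j + sigma / Num.sqrt n%:R * xi j w) ^+ 2.
have u0 j : (1 <= j)%N -> 0 <= u j by move=> j1; rewrite mulr_ge0 ?kappa0// sqr_ge0.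
have qE J : quad X a (signal sigma n theta) J w =
    (n%:R / sigma ^+ 2) ^+ 2 * \sum_(j < J) u j.+1.
  rewrite /quad big_distrr /=; apply: eq_bigr => j _.
  rewrite /a /u /signal /X.
  have -> : theta j.+1 * (Num.sqrt n%:R / sigma) + xi j.+1 w =
      (Num.sqrt n%:R / sigma) * (theta j.+1 + sigma / Num.sqrt n%:R * xi j.+1 w).
    by field; rewrite !gt_eqF.
  rewrite exprMn expr_div_n snE; ring.
rewrite /Tstat rhoE -EFinM leeBlDr// -EFinD.
have -> : (\sum_(1 <= j <oo)
    (kappa2 n j * (theta j + sigma / Num.sqrt n%:R * xi j w) ^+ 2)%:E)%E =
    (\sum_(1 <= j <oo) (u j)%:E)%E by [].
have eq J : (\sum_(j < J) u j.+1 <= t + sigma ^+ 2 / n%:R * s) =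
    (quad X a (signal sigma n theta) J w <= threshold sigma n s t).
  rewrite qE.
  have -> : threshold sigma n s t =
      (n%:R / sigma ^+ 2) ^+ 2 * (t + sigma ^+ 2 / n%:R * s).
    by rewrite /threshold; field; rewrite !gt_eqF.
  by rewrite ler_pM2l// exprn_gt0.
split.
  move=> /(nneseries1_leP _ _ _ u0) h; apply/(quad_series_leP _ _ _ _ _ a0) => J.
  by rewrite -eq.
move=> /(quad_series_leP _ _ _ _ _ a0) h; apply/(nneseries1_leP _ _ _ u0) => J.
by rewrite eq.
Qed.

Let Tset theta t : [set w | (Tstat sigma kappa2 xi theta n w <= t%:E)%E] =
  [set w | (quad_series X a (signal sigma n theta) w <= (threshold sigma n s t)%:E)%E].
Proof. by apply/seteqP; split => w /= /Tstat_le. Qed.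

Lemma beta_errE theta t : beta_err P sigma kappa2 xi n t theta =
  series_cdf P X a (signal sigma n theta) (threshold sigma n s t).
Proof. by rewrite /beta_err Tset. Qed.

Lemma alpha_errE mu v p t : square_noise P X mu v p ->
  alpha_err P sigma kappa2 xi n t =
  1 - series_cdf P X a (fun=> 0) (threshold sigma n s t).
Proof.
move=> nX; rewrite /alpha_err /series_cdf.
have a0 j : 0 <= a j by rewrite mulr_ge0 ?kappa0// ltW.
have -> : [set w | (t%:E < Tstat sigma kappa2 xi (fun=> 0%R) n w)%E] =
    ~` [set w | (quad_series X a (fun=> 0%R) w <= (threshold sigma n s t)%:E)%E].
  have sg0 : signal sigma n (fun=> 0) = (fun=> 0).
    by apply/funext => j; rewrite /signal mul0r.
  have := Tset (fun=> 0) t; rewrite sg0 => <-.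
  by apply/seteqP; split => w /=; rewrite ltNge => /negP.
have m := measurable_series_le _ _ _ _ _ nX a (fun=> 0) (threshold sigma n s t) a0.
by rewrite probability_setC// fineB// fin_num_measure.
Qed.

End Statistic.

(** * Comparison of the type II errors *)

Theorem theorem9 (R : realType) (sigma r : R) (phi : nat -> R -> R)
    (d : measure_display) (Omega : measurableType d) (P : probability Omega R)
    (xi : nat -> Omega -> R) (kappa2 : nat -> nat -> R) (f f1 : nat -> R -> R) :
  0 < sigma -> 0 < r < 2^-1 ->
  orthonormal_basis phi -> iid_std_normal P xi ->
  (forall n j, (1 <= j)%N -> 0 <= kappa2 n j) ->
  A1 kappa2 -> A2 sigma kappa2 -> A3 r kappa2 -> A4 kappa2 -> A5 kappa2 ->
  (forall n, L2_01 (f n)) -> (forall n, L2_01 (f1 n)) ->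
  consistent P sigma kappa2 xi phi f ->
  inconsistent P sigma kappa2 xi phi f1 ->
  forall a : R, 0 < a < 1 -> forall t : nat -> R,
    (fun n => alpha_err P sigma kappa2 xi n (t n)) @ \oo --> a ->
    (fun n => beta_err P sigma kappa2 xi n (t n) (coef phi (f n))
              - beta_err P sigma kappa2 xi n (t n) (coef phi (f n \+ f1 n)))
      @ \oo --> 0.
Proof.
move=> sigma0 r12 [phiL2 _ _] iid kappa0 hA1 hA2 hA3 _ hA5 fL2 f1L2 _ inc al al01 t talpha.
have [mu [v [p nX]]] := iid_std_normal_square_noise P xi iid.
set X := fun j => xi j.+1 in nX.
pose a n j := n%:R / sigma ^+ 2 * kappa2 n j.+1.
(* For n > 0 this is the value of rho, finite by (A3); at n = 0 nothing is claimed. *)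
pose s n := fine (rho kappa2 n).
have sE n : (0 < n)%N -> rho kappa2 n = (s n)%:E.
  by move=> n0; have [x _ rx] := rho_fin r kappa2 hA3 n n0; rewrite /s rx.
have [C1 C10 hC1] := sum_kappa4_gt sigma kappa2 sigma0 hA2.
have [C2 C20 hC2] := sum_kappa4_lt sigma kappa2 sigma0 hA2.
have N0 n : (0 < n)%N -> 0 < n%:R / sigma ^+ 2.
  by move=> n0; rewrite divr_gt0 ?exprn_gt0// ltr0n.
have am n : (0 < n)%N -> forall j, 0 <= a n j <= a n 0%N.
  move=> n0 j; have h := ltW (N0 n n0).
  by rewrite mulr_ge0 ?kappa0//= ler_wpM2l// hA1.
have m0 : (fun n => a n 0%N) @ \oo --> 0.
  exact: (weight_cvg0 sigma r kappa2 sigma0 r12 kappa0 hA1 hA2 hA3 hA5).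
have aA n : (0 < n)%N -> exists A, forall J, \sum_(j < J) a n j <= A.
  exact: (sum_kappa2_bounded sigma r kappa2 kappa0 hA3).
have aC2 n : (0 < n)%N -> forall J, \sum_(j < J) a n j ^+ 2 <= C2.
  by move=> n0 J; exact: hC2.
pose h n := signal sigma n (coef phi (f n)).
pose g n := signal sigma n (coef phi (f1 n)).
pose x n := threshold sigma n (s n) (t n).
have npos : \forall n \near \oo, (0 < n)%N by exists 1%N.
have alE n t' : (0 < n)%N -> alpha_err P sigma kappa2 xi n t' =
    1 - series_cdf P X (a n) (fun=> 0) (threshold sigma n (s n) t').
  move=> n0; exact: (alpha_errE P sigma kappa2 xi n (s n) sigma0 n0 (kappa0 n)
    (sE n n0) mu v p t' nX).
have beE n t' theta : (0 < n)%N -> beta_err P sigma kappa2 xi n t' theta =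
    series_cdf P X (a n) (signal sigma n theta) (threshold sigma n (s n) t').
  by move=> n0; exact: (beta_errE P sigma kappa2 xi n (s n) sigma0 n0 (kappa0 n) (sE n n0)).
have small := energy_small_of_undetectable P X mu v p nX a (fun n => a n 0%N) C2
  am m0 C20 aC2 aA g.
have {}small : forall delta : R, 0 < delta ->
    \forall n \near \oo, forall J, energy (a n) (g n) J <= delta.
  apply: small => y eps eps0.
  (* The preimage of [y n] under the affine map [threshold]; inconsistency admits any sequence of
     thresholds, so [y] is arbitrary. *)
  pose t' n := (y n - n%:R / sigma ^+ 2 * s n) / (n%:R / sigma ^+ 2) ^+ 2.
  have near1 := limn_einf_ge_near _ _ 1 eps eps0 (inc t').
  near=> n.
  have n0 : (0 < n)%N by near: n; exact: npos.
  have tE : threshold sigma n (s n) (t' n) = y n.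
    rewrite /threshold /t' mulrCA mulfV ?mulr1 ?subrK//.
    by rewrite gt_eqF// exprn_gt0// N0.
  have : 1 - eps <= alpha_err P sigma kappa2 xi n (t' n) +
      beta_err P sigma kappa2 xi n (t' n) (coef phi (f1 n)) by near: n; exact: near1.
  by rewrite alE// beE// tE -/(g n); lra.
have al0 : 0 < al by have /andP[] := al01.
have xal : (fun n => 1 - series_cdf P X (a n) (fun=> 0) (x n)) @ \oo --> al.
  apply: cvg_trans talpha; apply: near_eq_cvg; near=> n.
  by rewrite alE//; near: n; exact: npos.
have main := series_cdf_diff_cvg0 P X mu v p nX a (fun n => a n 0%N) C1 C2
  am m0 C10 C20 hC1 aC2 h g x al al0 xal small.
apply: cvg_trans main; apply: near_eq_cvg; near=> n.
have n0 : (0 < n)%N by near: n; exact: npos.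
rewrite !beE//; congr (_ - series_cdf _ _ _ _ _).
(* Fourier coefficients are additive on square integrable functions, so the rescaled signal of the
   sum is that of [h] plus that of [g]. *)
apply/funext => j; rewrite /h /g /signal coefD ?mulrDl//.
exact: phiL2.
Unshelve. all: by end_near.
Qed.
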